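(* For $i,j\ge0$ define $$d_{i,j}=\begin{cases}5I+J,&(i,j)=(2I,2J),\\ 5I+J+1,&(i,j)=(2I,2J+1),\\ 5I+J+3,&(i,j)=(2I+1,2J),\\ 5I+J+3,&(i,j)=(2I+1,2J+1).\end{cases}$$ Then for all $i,j\ge0$ and all $m$ with $0\le m<d_{i,j}$, $Z_{i,j}(m)=0$; furthermore $Z_{i,j}(d_{i,j})$ is an odd integer.
   Context: Let $E(q)=\prod_{m\ge1}(1-q^m)$. Define $$\gamma(q)=\frac{E(q)^5E(q^2)^5E(q^6)^5}{E(q^3)^{15}},\quad \xi=\xi(q)=\frac{E(q^2)^5E(q^6)}{E(q)E(q^3)^5},\quad \kappa(q)=\frac{\gamma(q^2)^2}{\gamma(q)},$$ and let $U\left(\sum_n a_nq^n\right)=\sum_n a_{2n}q^n$. For $i,j\ge0$, $\zeta_{i,j}=U(\kappa^i\xi^j)$; it is known that $\zeta_{i,j}$ equals a polynomial in $\xi$ with integer coefficients, and $Z_{i,j}(m)$ ($m\ge0$) denote its coefficients: $\zeta_{i,j}=\sum_m Z_{i,j}(m)\xi^m$. *)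

(* Defs.v *)
(* Formal power series in q with integer coefficients are
   represented by their coefficient sequences  nat -> int. *)
From mathcomp Require Import all_boot all_order all_algebra.
Set Implicit Arguments. Unset Strict Implicit. Unset Printing Implicit Defensive.
Import Order.TTheory GRing.Theory Num.Theory.
Local Open Scope ring_scope.

Definition ps := nat -> int.

Definition ps_one : ps := fun n => if n == 0%N then 1 else 0.
Definition ps_sub (a b : ps) : ps := fun n => a n - b n.
Definition ps_mul (a b : ps) : ps :=
  fun n => \sum_(k < n.+1) a k * b (n - k)%N.
Definition ps_pow (a : ps) (k : nat) : ps := iter k (ps_mul a) ps_one.
(* inverse of a series with constant term 1:  1/a = sum_k (1 - a)^k ;
   since (1 - a)^k = O(q^k), coefficient n only needs k <= n *)
Definition ps_inv (a : ps) : ps :=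
  fun n => \sum_(k < n.+1) ps_pow (ps_sub ps_one a) k n.
(* dilation  a(q) |-> a(q^k)  (k > 0) *)
Definition ps_dil (k : nat) (a : ps) : ps :=
  fun n => if (k %| n)%N then a (n %/ k)%N else 0.
Definition ps_U (a : ps) : ps := fun n => a (2 * n)%N.

(* E(q) = prod_{m>=1} (1 - q^m); its coefficient of q^n only depends on
   the factors with m <= n *)
Definition E : ps :=
  fun n => (\prod_(1 <= m < n.+1) (1 - 'X^m) : {poly int})`_n.

Definition gamma : ps :=
  ps_mul (ps_pow E 5)
   (ps_mul (ps_pow (ps_dil 2 E) 5)
     (ps_mul (ps_pow (ps_dil 6 E) 5) (ps_inv (ps_pow (ps_dil 3 E) 15)))).

Definition xi : ps :=
  ps_mul (ps_pow (ps_dil 2 E) 5)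
   (ps_mul (ps_dil 6 E) (ps_inv (ps_mul E (ps_pow (ps_dil 3 E) 5)))).

Definition kappa : ps := ps_mul (ps_pow (ps_dil 2 gamma) 2) (ps_inv gamma).

Definition zeta (i j : nat) : ps := ps_U (ps_mul (ps_pow kappa i) (ps_pow xi j)).

Definition ps_peval (P : {poly int}) (s : ps) : ps :=
  fun n => \sum_(m < size P) P`_m * ps_pow s m n.

Definition dij (i j : nat) : nat :=
  let I := i./2 in let J := j./2 in
  if odd i then (5 * I + J + 3)%N
  else if odd j then (5 * I + J + 1)%N
  else (5 * I + J)%N.

(* Main.v *)
Require Import Defs.
From HB Require Import structures.
From mathcomp Require Import all_boot all_order all_algebra.
From mathcomp Require Import boolp fraction zify ring.
Set Implicit Arguments. Unset Strict Implicit. Unset Printing Implicit Defensive.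
Import Order.TTheory GRing.Theory Num.Theory.
Local Open Scope ring_scope.

(* Write e_k = E(q^k), X = xi(q^2) and
     la = e_2 e_4^2 e_12^2 e_3^3 / (e_1 e_6^7), so that kappa = la^5.
   A 2-dissection of products of two theta functions gives la = X + s with s an odd series
   and s^2 = X^2 - X; here the theta functions are products by the Jacobi triple product.
   Jacobi's quartic identity phi(q)^4 - phi(-q)^4 = 16 q psi(q^2)^4, at q and at q^3, then
   forces xi = 2 X + (3 - 4 X) (X - s).  Hence kappa and xi are quadratic over Z[X]:
     xi^2 = (10 X - 8 X^2) xi - (9 X - 8 X^2),
     kappa^2 = (32 X^5 - 40 X^4 + 10 X^3) kappa - X^5.
   As U(a(q^2) b) = a U(b), this gives recurrences in i and in j for zeta_{i,j} over Z[xi].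
   In both, the coefficient of the first term is even and that of the second is odd in lowest
   degree, so the lowest terms of the four initial values propagate. *)

(** * The ring of formal power series *)

Record fps := Fps { cf : ps }.

Lemma fpsP (f g : fps) : cf f =1 cf g -> f = g.
Proof. by case: f g => [f] [g] /= /funext ->. Qed.

HB.instance Definition _ := gen_eqMixin fps.
HB.instance Definition _ := gen_choiceMixin fps.

Definition fps_zero := Fps (fun=> 0).
Definition fps_opp f := Fps (fun n => - cf f n).
Definition fps_add f g := Fps (fun n => cf f n + cf g n).
Definition fps_one := Fps ps_one.
Definition fps_mul f g := Fps (ps_mul (cf f) (cf g)).

Fact fps_addA : associative fps_add.
Proof. by move=> f g h; apply: fpsP => n; exact: addrA. Qed.
Fact fps_addC : commutative fps_add.
Proof. by move=> f g; apply: fpsP => n; exact: addrC. Qed.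
Fact fps_add0 : left_id fps_zero fps_add.
Proof. by move=> f; apply: fpsP => n; exact: add0r. Qed.
Fact fps_addN : left_inverse fps_zero fps_opp fps_add.
Proof. by move=> f; apply: fpsP => n; exact: addNr. Qed.

HB.instance Definition _ :=
  GRing.isZmodule.Build fps fps_addA fps_addC fps_add0 fps_addN.

(* The ring axioms are inherited from polynomials, to which a series is truncated. *)
Definition agree n (p : {poly int}) (a : ps) := forall m, (m <= n)%N -> p`_m = a m.

Lemma agree_trunc n a : agree n (\poly_(i < n.+1) a i) a.
Proof. by move=> m le_mn; rewrite coef_poly ltnS le_mn. Qed.

Lemma agree_mul n p r a b : agree n p a -> agree n r b -> agree n (p * r) (ps_mul a b).
Proof.
move=> pa rb m le_mn; rewrite coefM; apply: eq_bigr => k _.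
by rewrite pa ?rb ?(leq_trans _ le_mn) ?leq_subr // -ltnS.
Qed.

Lemma agree_one n : agree n 1 ps_one.
Proof. by move=> m _; rewrite coef1 /ps_one; case: eqP. Qed.

Fact fps_mulA : associative fps_mul.
Proof.
move=> f g h; apply: fpsP => n /=; have T := @agree_trunc n.
have H1 := agree_mul (T (cf f)) (agree_mul (T (cf g)) (T (cf h))).
have H2 := agree_mul (agree_mul (T (cf f)) (T (cf g))) (T (cf h)).
by rewrite -H1 // -H2 // mulrA.
Qed.

Fact fps_mulC : commutative fps_mul.
Proof.
move=> f g; apply: fpsP => n /=; have T := @agree_trunc n.
by rewrite -(agree_mul (T (cf f)) (T (cf g))) // -(agree_mul (T (cf g)) (T (cf f))) // mulrC.
Qed.

Fact fps_mul1 : left_id fps_one fps_mul.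
Proof.
move=> f; apply: fpsP => n /=; have T := @agree_trunc n.
by rewrite -(agree_mul (@agree_one n) (T (cf f))) // mul1r T.
Qed.

Fact fps_mulDl : left_distributive fps_mul fps_add.
Proof.
move=> f g h; apply: fpsP => n /=; rewrite /ps_mul -big_split.
by apply: eq_bigr => k _; exact: mulrDl.
Qed.

Fact fps_one_neq0 : fps_one != 0 :> fps.
Proof. by apply/eqP => /(congr1 (fun f => cf f 0%N)). Qed.

HB.instance Definition _ := GRing.Zmodule_isComNzRing.Build fps
  fps_mulA fps_mulC fps_mul1 fps_mulDl fps_one_neq0.

Lemma cf0 n : cf 0 n = 0. Proof. by []. Qed.
Lemma cf1 n : cf 1 n = (n == 0%N)%:R. Proof. by rewrite /= /ps_one; case: eqP. Qed.
Lemma cfD f g n : cf (f + g) n = cf f n + cf g n. Proof. by []. Qed.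
Lemma cfN f n : cf (- f) n = - cf f n. Proof. by []. Qed.
Lemma cfB f g n : cf (f - g) n = cf f n - cf g n. Proof. by []. Qed.
Lemma cfM f g n : cf (f * g) n = \sum_(k < n.+1) cf f k * cf g (n - k)%N.
Proof. by []. Qed.
Lemma cfM0 f g : cf (f * g) 0 = cf f 0%N * cf g 0%N.
Proof. by rewrite cfM big_ord_recl big_ord0 addr0. Qed.
Lemma cf_sum (I : Type) (r : seq I) (P : pred I) (F : I -> fps) n :
  cf (\sum_(i <- r | P i) F i) n = \sum_(i <- r | P i) cf (F i) n.
Proof. by apply: (big_morph (fun f => cf f n)). Qed.

Lemma Fps_pow a k : Fps (ps_pow a k) = Fps a ^+ k.
Proof. by elim: k => // k IH; rewrite exprS -IH. Qed.

(** Invertibility is decided classically and the inverse is chosen, so the ring structure rests on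
    no formula for inverses. *)
Definition funit : pred fps := fun f => `[< exists g, g * f = 1 >].
Definition finv (f : fps) : fps :=
  if pselect (exists g, g * f = 1) is left e then projT1 (cid e) else f.

Fact fps_mulV : {in funit, left_inverse 1 finv *%R}.
Proof.
move=> f /asboolP uf; rewrite /finv; case: pselect => // e.
by case: (cid e).
Qed.
Fact fps_unitPl f g : g * f = 1 -> funit f.
Proof. by move=> gf; apply/asboolP; exists g. Qed.
Fact fps_inv_out : {in [predC funit], finv =1 id}.
Proof.
by move=> f /negP nu; rewrite /finv; case: pselect => // e; case: nu; apply/asboolP.
Qed.

HB.instance Definition _ :=
  GRing.ComNzRing_hasMulInverse.Build fps fps_mulV fps_unitPl fps_inv_out.

Lemma fps_neq0 f : f != 0 -> exists2 n, cf f n != 0 & forall m, (m < n)%N -> cf f m = 0.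
Proof.
move=> f0; have ex : exists n, cf f n != 0.
  apply: contrapT => no; case/eqP: f0; apply: fpsP => n.
  by apply: contrapT => /eqP fn; apply: no; exists n.
exists (ex_minn ex); first by case: ex_minnP.
case: ex_minnP => n _ min m lt_mn; apply/eqP; apply: contraLR lt_mn => /min.
by rewrite -leqNgt.
Qed.

(** At the sum of the two orders, only the product of the lowest nonzero coefficients survives in
    the convolution. *)
Fact fps_integral : GRing.integral_domain_axiom fps.
Proof.
move=> f g fg0; apply: contrapT => /negP; rewrite negb_or => /andP[].
move=> /fps_neq0[m fm minm] /fps_neq0[n gn minn].
have: cf (f * g) (m + n)%N == cf f m * cf g n.
  rewrite cfM (bigD1 (Ordinal (leq_addr n m : (m < (m + n).+1)%N))) //= addKn big1 ?addr0 //.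
  move=> k /eqP km; have {}km : (k : nat) <> m by move=> e; apply: km; apply: val_inj.
  have [lt|ge] := ltnP k m; first by rewrite minm // mul0r.
  by rewrite minn ?mulr0 //; have := ltn_ord k; lia.
by rewrite fg0 cf0 eq_sym mulf_eq0 (negPf fm) (negPf gn).
Qed.

HB.instance Definition _ := GRing.ComUnitRing_isIntegral.Build fps fps_integral.

(** * Congruences and limits *)

Section Congruence.
Variable R : comNzRingType.
Implicit Types d x y z u : R.

(** For [d = qq ^+ N] this is agreement of the first [N] coefficients ([congqP]). Other moduli are
    needed too: the triple product is proved modulo powers of [a * b]. *)
Definition cong d x y := exists c, x - y = d * c.

Lemma cong_refl d x : cong d x x.
Proof. by exists 0; rewrite mulr0 subrr. Qed.

Lemma cong_sym d x y : cong d x y -> cong d y x.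
Proof. by case=> c e; exists (- c); rewrite mulrN -e opprB. Qed.

Lemma cong_trans d y x z : cong d x y -> cong d y z -> cong d x z.
Proof. by case=> c e [c' e']; exists (c + c'); rewrite mulrDr -e -e'; ring. Qed.

Lemma congD d x y z u : cong d x y -> cong d z u -> cong d (x + z) (y + u).
Proof. by case=> c e [c' e']; exists (c + c'); rewrite mulrDr -e -e'; ring. Qed.

Lemma congM d x y z u : cong d x y -> cong d z u -> cong d (x * z) (y * u).
Proof.
case=> c e [c' e']; exists (c * z + y * c').
have -> : d * (c * z + y * c') = (d * c) * z + y * (d * c') by ring.
by rewrite -e -e'; ring.
Qed.

Lemma congX d x y n : cong d x y -> cong d (x ^+ n) (y ^+ n).
Proof.
move=> e; elim: n => [|n IH]; first exact: cong_refl.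
by rewrite !exprS; apply: congM.
Qed.

Lemma cong_sum d (I : eqType) (r : seq I) (P : pred I) (F G : I -> R) :
  (forall i, i \in r -> P i -> cong d (F i) (G i)) ->
  cong d (\sum_(i <- r | P i) F i) (\sum_(i <- r | P i) G i).
Proof.
move=> FG; rewrite big_seq_cond [X in cong d _ X]big_seq_cond.
apply: (big_ind2 (cong d)) => [||i /andP[ir Pi]]; last exact: FG.
  exact: cong_refl.
by move=> *; apply: congD.
Qed.

Lemma cong_mull d x y z : cong d x y -> cong (z * d) (z * x) (z * y).
Proof. by case=> c e; exists c; rewrite -mulrBr e mulrA. Qed.

Lemma cong_dvd d e x y : cong (d * e) x y -> cong d x y.
Proof. by case=> c xy; exists (e * c); rewrite xy mulrA. Qed.

Lemma cong_pow_leq d m n x y : (m <= n)%N -> cong (d ^+ n) x y -> cong (d ^+ m) x y.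
Proof. by move=> /subnKC <-; rewrite exprD; apply: cong_dvd. Qed.

Lemma cong_exp_base d e n x y : cong d e 0 -> cong (e ^+ n) x y -> cong (d ^+ n) x y.
Proof. by case=> c; rewrite subr0 => ->; rewrite exprMn; apply: cong_dvd. Qed.

(** Both sums reduce to the common part of [r] and [s]. This compares truncations of one infinite
    sum to index sets of different shapes. *)
Lemma cong_sum_support d (I : eqType) (r s : seq I) (F : I -> R) : uniq r -> uniq s ->
  (forall i, i \in r -> i \notin s -> cong d (F i) 0) ->
  (forall i, i \in s -> i \notin r -> cong d (F i) 0) ->
  cong d (\sum_(i <- r) F i) (\sum_(i <- s) F i).
Proof.
have drop (r1 s1 : seq I) : (forall i, i \in r1 -> i \notin s1 -> cong d (F i) 0) ->
    cong d (\sum_(i <- r1) F i) (\sum_(i <- [seq i <- r1 | i \in s1]) F i).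
  move=> H; rewrite (bigID (mem s1)) /= big_filter -[X in cong d _ X]addr0.
  apply: congD; first exact: cong_refl.
  apply: (@cong_trans _ (\sum_(i <- r1 | i \notin s1) 0)); first exact: cong_sum.
  by rewrite big1 //; apply: cong_refl.
move=> ur us Hr Hs; apply: cong_trans (drop _ _ Hr) _.
rewrite (perm_big [seq i <- s | i \in r]) /=; first exact/cong_sym/drop.
by apply: uniq_perm; rewrite ?filter_uniq // => i; rewrite !mem_filter andbC.
Qed.

End Congruence.
#[global] Hint Resolve cong_refl : core.

Definition qq : fps := Fps (fun n => (n == 1%N)%:R).

Lemma cf_qqM f n : cf (qq * f) n = if n is m.+1 then cf f m else 0.
Proof.
rewrite cfM; case: n => [|n]; first by rewrite big_ord_recl big_ord0 mul0r addr0.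
rewrite big_ord_recl big_ord_recl big1 ?addr0 /= ?mul0r ?add0r ?mul1r ?subn1 // => k _.
by rewrite /= mul0r.
Qed.

Lemma cf_qqXM k f n : cf (qq ^+ k * f) n = if (n < k)%N then 0 else cf f (n - k)%N.
Proof.
elim: k n => [|k IH] n; first by rewrite mul1r subn0.
by rewrite exprS -mulrA cf_qqM; case: n => // n; rewrite IH.
Qed.

Lemma qq_neq0 : qq != 0.
Proof. by apply/eqP => /(congr1 (fun f => cf f 1%N)). Qed.

Lemma congqP N f g : cong (qq ^+ N) f g <-> (forall m, (m < N)%N -> cf f m = cf g m).
Proof.
split=> [[c e] m lt_mN|fg].
  by apply/eqP; rewrite -subr_eq0 -cfB e cf_qqXM lt_mN.
exists (Fps (fun n => cf (f - g) (n + N)%N)); apply: fpsP => n.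
rewrite cf_qqXM; case: ltnP => [/fg fgn|le]; first by rewrite cfB fgn subrr.
by rewrite /= subnK.
Qed.

Lemma congq_eq f g : (forall N, cong (qq ^+ N) f g) -> f = g.
Proof. by move=> fg; apply: fpsP => n; have /congqP/(_ n (leqnn _)) := fg n.+1. Qed.

(** The index is [n.+1] because consecutive terms will agree modulo [qq ^+ N] from [u N] on, which
    fixes coefficient [n] only once [N] exceeds [n]. *)
Definition flim (u : nat -> fps) : fps := Fps (fun n => cf (u n.+1) n).

Lemma flim_cong u : (forall N, cong (qq ^+ N) (u N.+1) (u N)) ->
  forall N M, (N <= M)%N -> cong (qq ^+ N) (flim u) (u M).
Proof.
move=> Hu N M le_NM; have mono n m : (n <= m)%N -> cong (qq ^+ n) (u m) (u n).
  move=> /subnKC <-; elim: (m - n)%N => [|k IH]; first by rewrite addn0.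
  rewrite addnS; apply: cong_trans _ IH; apply: cong_pow_leq (Hu _).
  by rewrite leq_addr.
apply/congqP => m lt_mN /=; have /mono/congqP -> // : (m.+1 <= M)%N by exact: leq_trans lt_mN _.
Qed.

(** With [u = 1 - f] divisible by [qq], the inverse is the limit of the geometric sums [s n], and
    [s n * f = 1 - u ^+ n] tends to [1]. *)
Lemma ps_invK f : cf f 0 = 1 -> Fps (ps_inv (cf f)) * f = 1.
Proof.
move=> f0; pose u := 1 - f.
have uq : cong qq u 0.
  by rewrite -[qq]expr1; apply/congqP => -[] // _; rewrite cfB f0 cf1 subrr.
have upow n : cong (qq ^+ n) (u ^+ n) 0.
  by case: uq => c; rewrite !subr0 => ->; exists (c ^+ n); rewrite subr0 exprMn.
pose s n := \sum_(k < n) u ^+ k.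
have -> : Fps (ps_inv (cf f)) = flim s.
  apply: fpsP => n; rewrite [RHS]/= cf_sum; apply: eq_bigr => k _.
  by rewrite -[LHS]/(cf (Fps _) n) Fps_pow.
have sE n : s n * f = 1 - u ^+ n.
  have fE : f = 1 - u by rewrite /u; ring.
  by rewrite -[RHS]opprB subrX1 fE -/(s n); ring.
have s_cauchy N : cong (qq ^+ N) (s N.+1) (s N).
  by rewrite /s big_ord_recr /= -[X in cong _ _ X]addr0; apply: congD.
apply: congq_eq => N; apply: (@cong_trans _ _ (s N * f)).
  by apply: congM => //; apply: flim_cong.
have [c e] := upow N; exists (- c); rewrite sE mulrN -e; ring.
Qed.

Lemma fps_unit f : cf f 0 = 1 -> f \is a GRing.unit.
Proof. by move=> /ps_invK e; apply/unitrPr; exists (Fps (ps_inv (cf f))); rewrite mulrC. Qed.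

(** * The Jacobi triple product *)

Lemma double_bin2 n : (2 * 'C(n.+1, 2) = n * n.+1)%N.
Proof. by elim: n => // n IH; rewrite binS bin1 mulnDr IH; lia. Qed.

(** The triangular number [j (j + 1) / 2]. As [Negz n] is [- (n + 1)], both branches give the same
    binomial. *)
Definition tri (j : int) : nat :=
  match j with Posz n => 'C(n.+1, 2) | Negz n => 'C(n.+1, 2) end.

Lemma triE j : 2 * (tri j)%:Z = j * (j + 1).
Proof. by case: j => n /=; have := double_bin2 n; lia. Qed.

(** * Gaussian binomial coefficients *)

Section GaussBinomial.
Variables (R : comNzRingType) (p : R).

Fixpoint gbin (n k : nat) : R :=
  match n, k with
  | _, 0 => 1
  | 0, _.+1 => 0
  | n'.+1, k'.+1 => gbin n' k'.+1 + p ^+ (n' - k') * gbin n' k'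
  end.

Definition poch (n : nat) : R := \prod_(i < n) (1 - p ^+ i.+1).

Lemma gbin0 n : gbin n 0 = 1. Proof. by case: n. Qed.

Lemma gbin_small n k : (n < k)%N -> gbin n k = 0.
Proof.
elim: n k => [|n IH] [|k] //= lt_nk.
by rewrite !IH ?mulr0 ?addr0 // ltnW.
Qed.

(** The factorial formula for the Gaussian binomial, cleared of denominators. The induction step is
    the Pascal rule together with [1 - p^(n+1) = (1 - p^(n-k)) + p^(n-k) (1 - p^(k+1))]. *)
Lemma poch_gbin n k : (k <= n)%N -> poch k * poch (n - k) * gbin n k = poch n.
Proof.
have pS m : poch m.+1 = poch m * (1 - p ^+ m.+1) by rewrite /poch big_ord_recr.
elim: n k => [|n IH] [|k] //= le_kn.
- by rewrite /poch !big_ord0 !mulr1.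
- by rewrite subn0 mulr1 /poch big_ord0 mul1r.
rewrite subSS; move: le_kn; rewrite ltnS leq_eqVlt => /predU1P[->|lt_kn].
  rewrite gbin_small // add0r subnn mul1r /poch big_ord0 mulr1 -/(poch n) -/(poch n.+1).
  rewrite pS -[in RHS](IH n) // subnn [poch 0]/poch big_ord0; ring.
have E1 := IH k.+1 lt_kn; have E2 := IH k (ltnW lt_kn).
have dE : (n - k = (n - k.+1).+1)%N by rewrite -subSn.
have -> : poch k.+1 * poch (n - k) * (gbin n k.+1 + p ^+ (n - k) * gbin n k) =
  (1 - p ^+ (n - k)) * (poch k.+1 * poch (n - k.+1) * gbin n k.+1)
  + p ^+ (n - k) * (1 - p ^+ k.+1) * (poch k * poch (n - k) * gbin n k).
  by rewrite (pS k) dE (pS (n - k.+1)%N); ring.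
rewrite E1 E2 pS; have -> : p ^+ n.+1 = p ^+ (n - k) * p ^+ k.+1.
  by rewrite -exprD; congr (_ ^+ _); lia.
by ring.
Qed.

(** The form homogeneous in [x] and [y] lets [finite_jacobi] centre the product without negative
    powers of [p]. *)
Lemma gauss_binomial x y n : \prod_(i < n) (y + x * p ^+ i) =
  \sum_(k < n.+1) gbin n k * p ^+ 'C(k, 2) * x ^+ k * y ^+ (n - k).
Proof.
elim: n => [|n IH]; first by rewrite big_ord0 big_ord_recl big_ord0 /=; ring.
rewrite big_ord_recr /= IH mulrDr [RHS]big_ord_recl /=.
under [in RHS]eq_bigr => k _.
  rewrite /bump /= add1n subSS mulrDl mulrDl mulrDl.
  over.
rewrite big_split /= addrA; congr (_ + _).
  rewrite big_distrl /= [LHS]big_ord_recl [X in _ = _ + X]big_ord_recr /=.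
  rewrite add0n (gbin_small (ltnSn n)) !mul0r addr0 gbin0; congr (_ + _).
    by rewrite !subn0 exprSr; ring.
  apply: eq_bigr => k _; rewrite /bump /= add1n add0n.
  by rewrite (_ : n - k = (n - k.+1).+1)%N ?exprSr; [ring | have := ltn_ord k; lia].
rewrite big_distrl /=; apply: eq_bigr => k _; rewrite add0n.
have -> : p ^+ n = p ^+ (n - k) * p ^+ k by rewrite -exprD subnK // -ltnS.
by rewrite (binS k 1) bin1 exprD exprSr; ring.
Qed.

Lemma poch_cong m n : (m <= n)%N -> cong (p ^+ m.+1) (poch n) (poch m).
Proof.
move=> /subnKC <-; elim: (n - m)%N => [|k IH]; first by rewrite addn0.
rewrite addnS [poch _.+1]/poch big_ord_recr /= -/(poch _) -[X in cong _ _ X]mulr1.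
apply: congM => //; exists (- p ^+ k); rewrite mulrN -exprD addSn; ring.
Qed.

End GaussBinomial.

(** The general term [a^(j(j+1)/2) b^(j(j-1)/2)] of Ramanujan's theta function [f(a, b)]. *)
Definition tterm (R : comNzRingType) (a b : R) (j : int) : R := a ^+ tri j * b ^+ tri (- j).

(** Take [2 N] factors in [gauss_binomial] with [x = p] and [y = b p^N]. The first [N] factors are
    [p^(i+1) (1 + b p^(N-1-i))], the last [N] are [b p^N (1 + a p^i)]. The monomials pulled out
    multiply to [D], which is then cancelled. *)
Lemma finite_jacobi (R : idomainType) (a b : R) (N : nat) : a != 0 -> b != 0 ->
  \prod_(i < N) ((1 + a * (a * b) ^+ i) * (1 + b * (a * b) ^+ i)) =
  \sum_(k < (2 * N).+1) gbin (a * b) (2 * N) k * tterm a b (k%:Z - N%:Z).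
Proof.
move=> a0 b0; set p := a * b; pose D := p ^+ 'C(N.+1, 2) * (b * p ^+ N) ^+ N.
have p0 : p != 0 by rewrite mulf_neq0.
have D0 : D != 0 by rewrite mulf_neq0 ?expf_neq0 ?mulf_neq0 ?expf_neq0.
apply: (mulfI D0); have := gauss_binomial p p (b * p ^+ N) (2 * N).
have pT : \prod_(i < N) p ^+ i.+1 = p ^+ 'C(N.+1, 2).
  by elim: (N) => [|m IH]; rewrite ?big_ord0 // big_ord_recr /= IH -exprD [in RHS]binS bin1.
have lo : \prod_(i < N) (b * p ^+ N + p * p ^+ i) =
    p ^+ 'C(N.+1, 2) * \prod_(i < N) (1 + b * p ^+ i).
  rewrite [X in _ = _ * X](reindex_inj rev_ord_inj) -pT -big_split /=.
  apply: eq_bigr => i _; rewrite mulrDr mulr1 mulrCA -exprD addrC exprS.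
  by congr (_ + b * _ ^+ _); have := ltn_ord i; lia.
have hi : \prod_(i < N) (b * p ^+ N + p * p ^+ (N + i)) =
    (b * p ^+ N) ^+ N * \prod_(i < N) (1 + a * p ^+ i).
  have <- : \prod_(i < N) (b * p ^+ N) = (b * p ^+ N) ^+ N by rewrite prodr_const card_ord.
  rewrite -big_split /=.
  by apply: eq_bigr => i _; rewrite exprD /p; ring.
have -> : \prod_(i < 2 * N) (b * p ^+ N + p * p ^+ i) =
    D * \prod_(i < N) ((1 + a * p ^+ i) * (1 + b * p ^+ i)).
  by rewrite mul2n -addnn big_split_ord /= lo hi big_split /= /D; ring.
move=> ->; rewrite big_distrr /=; apply: eq_bigr => k _.
rewrite mulrCA -!mulrA; congr (_ * _).
have TN := double_bin2 N; have le_k : (k <= 2 * N)%N by rewrite -ltnS.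
have [Tj Tj'] := (triE (k%:Z - N%:Z), triE (- (k%:Z - N%:Z))).
have Tk : (2 * ('C(k, 2) + k) = k * k.+1)%N by rewrite -double_bin2 binS bin1; lia.
rewrite /D /tterm /p !exprMn -!exprM.
transitivity (a ^+ ('C(k, 2) + k + N * (2 * N - k)) *
    b ^+ ('C(k, 2) + k + (2 * N - k) + N * (2 * N - k))); first by rewrite !exprD; ring.
transitivity (a ^+ ('C(N.+1, 2) + N * N + tri (k%:Z - N%:Z)) *
    b ^+ ('C(N.+1, 2) + N + N * N + tri (- (k%:Z - N%:Z)))); last by rewrite !exprD; ring.
by congr (_ ^+ _ * _ ^+ _); nia.
Qed.

Definition zrange (N : nat) : seq int := [seq k%:Z - N%:Z | k <- iota 0 (2 * N).+1].

Lemma mem_zrange N j : (j \in zrange N) = (absz j <= N)%N.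
Proof.
apply/mapP/idP => [[k + ->]|le_jN]; first by rewrite mem_iota; lia.
by exists (absz (j + N%:Z)); rewrite ?mem_iota; lia.
Qed.

Lemma zrange_uniq N : uniq (zrange N).
Proof. by rewrite map_inj_uniq ?iota_uniq // => k l; lia. Qed.

(** Both exponents [j(j+1)/2] and [j(j-1)/2] are at least [|j| - 1]. *)
Lemma tterm_small (R : comNzRingType) (a b : R) (j : int) :
  cong ((a * b) ^+ (absz j).-1) (tterm a b j) 0.
Proof.
have [Tj Tj'] := (triE j, triE (- j)).
exists (a ^+ (tri j - (absz j).-1) * b ^+ (tri (- j) - (absz j).-1)).
rewrite subr0 /tterm exprMn mulrACA -!exprD.
by congr (_ ^+ _ * _ ^+ _); rewrite subnKC //; nia.
Qed.

Section Jacobi.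
Variables a b : fps.
Let p := a * b.
Hypothesis p_q : cong qq p 0.
Hypotheses (a0 : a != 0) (b0 : b != 0).

Lemma poch_unit n : poch p n \is a GRing.unit.
Proof.
have p0 : cf p 0%N = 0.
  by move: p_q; rewrite -[X in cong X]expr1 => /congqP/(_ 0%N isT).
apply: fps_unit; elim: n => [|n IH]; first by rewrite /poch big_ord0 cf1.
by rewrite /poch big_ord_recr cfM0 -/(poch p n) IH cfB cf1 exprS cfM0 p0 mul0r.
Qed.

(** Here [r = N - |j|]. Modulo [p^(r+1)] all of [poch p N], [poch p k], [poch p (2 * N - k)] and
    [poch p (2 * N)] equal the unit [poch p r], so the coefficient is [1] by [poch_gbin]. The theta
    term supplies another [|j| - 1] powers of [p], enough to reach [p^N]. *)
Lemma jacobi_term N k : (k <= 2 * N)%N ->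
  cong (p ^+ N) (poch p N * gbin p (2 * N) k * tterm a b (k%:Z - N%:Z))
    (tterm a b (k%:Z - N%:Z)).
Proof.
move=> le_k; set j := _ - _; pose r := minn k (2 * N - k).
have Hr m : (r <= m)%N -> cong (p ^+ r.+1) (poch p m) (poch p r) by apply: poch_cong.
have U : cong (p ^+ r.+1) (poch p N * gbin p (2 * N) k) 1.
  have e := poch_gbin p le_k.
  have {e} : cong (p ^+ r.+1) (poch p r * poch p r * gbin p (2 * N) k) (poch p r).
    apply: cong_trans (Hr (2 * N)%N _); last by rewrite /r; lia.
    rewrite -e; apply: cong_sym; apply: congM => //.
    by apply: congM; apply: Hr; rewrite /r; lia.
  move=> [c e]; apply: cong_trans (_ : cong _ (poch p r * gbin p (2 * N) k) _).
    by apply: congM => //; apply: Hr; rewrite /r; lia.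
  exists ((poch p r)^-1 * c); rewrite mulrCA -e mulrBr -!mulrA mulKr ?mulVr ?poch_unit //.
have [c tE] := tterm_small a b j; rewrite subr0 -/p in tE.
rewrite -[X in cong _ _ X]mul1r tE mulrA [X in cong _ _ X]mulrA.
apply: congM => //; rewrite mulrC [X in cong _ _ X]mulrC.
apply: (@cong_pow_leq _ _ _ ((absz j).-1 + r.+1)); first by rewrite /r; lia.
by rewrite exprD; apply: cong_mull.
Qed.

Definition jac_prod N := \prod_(i < N) ((1 + a * p ^+ i) * (1 + b * p ^+ i) * (1 - p ^+ i.+1)).
Definition jac := flim jac_prod.

Lemma jac_cong N M : (N <= M)%N -> cong (qq ^+ N) jac (jac_prod M).
Proof.
apply: flim_cong => {M}N; rewrite /jac_prod big_ord_recr /= -[X in cong _ _ X]mulr1.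
apply: congM => //; apply: cong_exp_base p_q _.
exists (a + b + a * b * p ^+ N - p * (1 + a * p ^+ N) * (1 + b * p ^+ N)).
by rewrite exprS; ring.
Qed.

Lemma jacobi_triple_product N : cong (qq ^+ N) jac (\sum_(j <- zrange N) tterm a b j).
Proof.
apply: cong_trans (jac_cong (leqnn N)) _; apply: cong_exp_base p_q _.
rewrite /jac_prod big_split /= finite_jacobi // mulrC -/(poch p N) big_distrr /=.
rewrite big_map -[iota _ _]/(index_iota 0 (2 * N).+1) big_mkord.
apply: cong_sum => k _ _; rewrite mulrA; apply: jacobi_term.
by rewrite -ltnS.
Qed.

End Jacobi.

(** * The 2-dissection of a product of two theta functions *)

Section Dissection.
Variables (R : comNzRingType) (a g : R).

Let e12 n : (a * g ^+ 2) ^+ n = a ^+ n * g ^+ (2 * n).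
Proof. by rewrite exprMn -exprM. Qed.
Let e11 n : (a * g) ^+ n = a ^+ n * g ^+ n.
Proof. by rewrite exprMn. Qed.
Let e21 n : (a ^+ 2 * g) ^+ n = a ^+ (2 * n) * g ^+ n.
Proof. by rewrite exprMn -exprM. Qed.
Let e23 n : (a ^+ 2 * g ^+ 3) ^+ n = a ^+ (2 * n) * g ^+ (3 * n).
Proof. by rewrite exprMn -!exprM. Qed.
Let e43 n : (a ^+ 4 * g ^+ 3) ^+ n = a ^+ (4 * n) * g ^+ (3 * n).
Proof. by rewrite exprMn -!exprM. Qed.

(** Both sides are monomials in [a] and [g]; the quadratic parts of the exponents match by
    [(u + v)^2 + (u - v)^2 = 2 u^2 + 2 v^2]. *)
Lemma tterm_even u v :
  tterm a (a * g ^+ 2) (u + v) * tterm (a * g) (a * g) (u - v) =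
  tterm (a ^+ 2 * g) (a ^+ 2 * g ^+ 3) u * tterm (a ^+ 2 * g) (a ^+ 2 * g ^+ 3) v.
Proof.
have [H1 H2] := (triE (u + v), triE (- (u + v))).
have [H3 H4] := (triE (u - v), triE (- (u - v))).
have [[H5 H6] [H7 H8]] := ((triE u, triE (- u)), (triE v, triE (- v))).
rewrite /tterm !(e12, e11, e21, e23, e43).
transitivity (a ^+ (tri (u + v) + tri (- (u + v)) + tri (u - v) + tri (- (u - v)))
  * g ^+ (2 * tri (- (u + v)) + tri (u - v) + tri (- (u - v)))).
  by rewrite !exprD; ring.
transitivity (a ^+ (2 * tri u + 2 * tri (- u) + 2 * tri v + 2 * tri (- v))
  * g ^+ (tri u + 3 * tri (- u) + tri v + 3 * tri (- v))); last by rewrite !exprD; ring.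
by congr (_ ^+ _ * _ ^+ _); nia.
Qed.

Lemma tterm_odd u v :
  tterm a (a * g ^+ 2) (u + v + 1) * tterm (a * g) (a * g) (u - v) =
  a * (tterm (a ^+ 4 * g ^+ 3) g u * tterm (a ^+ 4 * g ^+ 3) g v).
Proof.
have [H1 H2] := (triE (u + v + 1), triE (- (u + v + 1))).
have [H3 H4] := (triE (u - v), triE (- (u - v))).
have [[H5 H6] [H7 H8]] := ((triE u, triE (- u)), (triE v, triE (- v))).
rewrite /tterm !(e12, e11, e21, e23, e43).
transitivity (a ^+ (tri (u + v + 1) + tri (- (u + v + 1)) + tri (u - v) + tri (- (u - v)))
  * g ^+ (2 * tri (- (u + v + 1)) + tri (u - v) + tri (- (u - v)))).
  by rewrite !exprD; ring.
transitivity (a ^+ (4 * tri u + 4 * tri v + 1)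
  * g ^+ (3 * tri u + tri (- u) + 3 * tri v + tri (- v))); last by rewrite !exprD; ring.
by congr (_ ^+ _ * _ ^+ _); nia.
Qed.

End Dissection.

Lemma tterm_out (a b : fps) N (j : int) : cong qq (a * b) 0 -> j \notin zrange N ->
  cong (qq ^+ N) (tterm a b j) 0.
Proof.
move=> ab; rewrite mem_zrange => Nj; have := tterm_small a b j.
move=> /(cong_exp_base ab); apply: cong_pow_leq; lia.
Qed.

(* The double sum over (m, n) splits by the parity of m + n: put m = u + v or u + v + 1,
   and n = u - v. *)
Lemma jac_dissection (a g : fps) : cong qq (a * g) 0 -> a != 0 -> g != 0 ->
  jac a (a * g ^+ 2) * jac (a * g) (a * g) =
  jac (a ^+ 2 * g) (a ^+ 2 * g ^+ 3) ^+ 2 + a * jac (a ^+ 4 * g ^+ 3) g ^+ 2.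
Proof.
move=> [c]; rewrite subr0 => agq a0 g0.
have q1 : cong qq (a * (a * g ^+ 2)) 0.
  by exists (c * (a * g)); rewrite subr0 [RHS]mulrA -agq; ring.
have q2 : cong qq (a * g * (a * g)) 0 by exists (c * (a * g)); rewrite subr0 [RHS]mulrA -agq.
have q3 : cong qq (a ^+ 2 * g * (a ^+ 2 * g ^+ 3)) 0.
  by exists (c * (a * g) ^+ 3); rewrite subr0 [RHS]mulrA -agq; ring.
have q4 : cong qq (a ^+ 4 * g ^+ 3 * g) 0.
  by exists (c * (a * g) ^+ 3); rewrite subr0 [RHS]mulrA -agq; ring.
apply: congq_eq => N.
have J x y (pq : cong qq (x * y) 0) x0 y0 := @jacobi_triple_product x y pq x0 y0 N.
apply: cong_trans (congM (J _ _ q1 _ _) (J _ _ q2 _ _)) _; rewrite ?mulf_neq0 ?expf_neq0 //.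
apply: cong_trans (cong_sym (congD (congX 2 (J _ _ q3 _ _))
  (congM (cong_refl _ a) (congX 2 (J _ _ q4 _ _))))); rewrite ?mulf_neq0 ?expf_neq0 //.
set z := zrange N; pose F (mn : int * int) :=
  tterm a (a * g ^+ 2) mn.1 * tterm (a * g) (a * g) mn.2.
have pairE (G H : int -> fps) : (\sum_(j <- z) G j) * (\sum_(j <- z) H j) =
    \sum_(u <- z) \sum_(v <- z) (G u * H v).
  by rewrite big_distrl; apply: eq_bigr => u _; rewrite big_distrr.
rewrite !expr2 !pairE big_distrr /=.
under [X in cong _ _ (X + _)]eq_bigr do under eq_bigr do rewrite -tterm_even.
under [X in cong _ _ (_ + X)]eq_bigr do rewrite big_distrr /=.
under [X in cong _ _ (_ + X)]eq_bigr do under eq_bigr do rewrite -tterm_odd.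
pose s0 := [seq (m, n) | m <- z, n <- z].
pose s1 := [seq (u + v, u - v) | u <- z, v <- z].
pose s2 := [seq (u + v + 1, u - v) | u <- z, v <- z].
have -> : \sum_(u <- z) \sum_(v <- z) (tterm a (a * g ^+ 2) u * tterm (a * g) (a * g) v) =
    \sum_(i <- s0) F i by rewrite /s0 big_allpairs_dep.
have -> : \sum_(u <- z) \sum_(v <- z)
    (tterm a (a * g ^+ 2) (u + v) * tterm (a * g) (a * g) (u - v)) = \sum_(i <- s1) F i.
  by rewrite /s1 big_allpairs_dep.
have -> : \sum_(u <- z) \sum_(v <- z)
    (tterm a (a * g ^+ 2) (u + v + 1) * tterm (a * g) (a * g) (u - v)) = \sum_(i <- s2) F i.
  by rewrite /s2 big_allpairs_dep.
rewrite -big_cat; have uz := zrange_uniq N.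
have in0 m n : ((m, n) \in s0) = (m \in z) && (n \in z).
  by apply/allpairsP/andP => [[[i j] [? ? [-> ->]]] // | []]; exists (m, n).
(* The lists [s1] and [s2] are disjoint by the parity of [m + n], and together they contain the
   square [s0]. A pair of theirs outside [s0] has a coordinate beyond [N], so its term vanishes
   modulo [qq ^+ N]. *)
apply: cong_sum_support.
- by apply: allpairs_uniq => // -[? ?] [? ?] _ _ [-> ->].
- rewrite cat_uniq; apply/and3P; split.
  + by apply: allpairs_uniq => // -[u v] [u' v'] _ _ /= [? ?]; congr (_, _); lia.
  + by apply/hasPn => -[m n] /allpairsP[[u v] /= [_ _ [-> ->]]]; apply/negP => /allpairsP[[u' v'] /= [_ _ [? ?]]]; lia.
  + by apply: allpairs_uniq => // -[u v] [u' v'] _ _ /= [? ?]; congr (_, _); lia.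
- move=> [m n]; rewrite in0 => /andP[mz nz] /negP[]; rewrite mem_cat.
  rewrite /z !mem_zrange in mz nz.
  have [par|par] : (exists w, m + n = 2 * w) \/ (exists w, m + n = 2 * w + 1).
  + by have := divz_eq (m + n) 2; have := @modz_ge0 (m + n) 2 isT; have := ltz_pmod (m + n) (isT : 0 < 2 :> int);
     case: (ltrP 0 ((m + n) %% 2)%Z) => *; [right | left]; exists ((m + n) %/ 2)%Z; lia.
  + case: par => w e; apply/orP; left; apply/allpairsP; exists (w, w - n) => /=.
    by rewrite /z !mem_zrange; split; [lia | lia | congr (_, _); lia].
  + case: par => w e; apply/orP; right; apply/allpairsP; exists (w, w - n) => /=.
    by rewrite /z !mem_zrange; split; [lia | lia | congr (_, _); lia].
- move=> [m n] _; rewrite in0 negb_and /F => /orP[mz|nz].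
  + by rewrite -[0](mul0r (tterm (a * g) (a * g) n)); apply: congM => //; apply: tterm_out.
  + by rewrite -[0](mulr0 (tterm a (a * g ^+ 2) m)); apply: congM => //; apply: tterm_out.
Qed.

(** * Eta products *)

Definition fdil k f := Fps (ps_dil k (cf f)).

Section Dilation.
Variable k : nat.

Fact fdil_zmod : zmod_morphism (fdil k.+1).
Proof.
by move=> f g; apply: fpsP => n; rewrite /= /ps_dil; case: ifP => //; rewrite subrr.
Qed.

(** On truncations, dilation is composition with a power of ['X], which is multiplicative. *)
Fact fdil_monoid : monoid_morphism (fdil k.+1).
Proof.
split=> [|f g]; apply: fpsP => n.
  rewrite /= /ps_dil /ps_one; case: (posnP n) => [->|n0]; first by rewrite div0n dvdn0.
  case: ifP => // /divnK e; case: eqP => // d0.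
  by move: n0; rewrite -e d0.
have comp (p : {poly int}) h : agree n p (cf h) ->
    agree n (p \Po 'X^(k.+1)) (cf (fdil k.+1 h)).
  move=> ph m le_mn; rewrite coef_comp_poly_Xn // /= /ps_dil.
  by case: ifP => // _; rewrite ph // (leq_trans (leq_div _ _)).
have Tf := @agree_trunc n (cf f); have Tg := @agree_trunc n (cf g).
have H1 := comp _ (f * g) (agree_mul Tf Tg).
have H2 := agree_mul (comp _ f Tf) (comp _ g Tg).
by rewrite -[LHS]H1 // -[RHS]H2 // comp_polyM.
Qed.

HB.instance Definition _ := GRing.isZmodMorphism.Build fps fps (fdil k.+1) fdil_zmod.
HB.instance Definition _ := GRing.isMonoidMorphism.Build fps fps (fdil k.+1) fdil_monoid.

Lemma fdil_qq : fdil k.+1 qq = qq ^+ k.+1.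
Proof.
apply: fpsP => n; rewrite -[qq ^+ k.+1]mulr1 cf_qqXM cf1 /= /ps_dil.
case: ifP => [/dvdnP[[|[|m]] ->]|ndvd].
- by rewrite div0n.
- by rewrite mul1n divnn ltnn subnn.
- rewrite mulnK // -{4}[k.+1]mul1n -mulnBl ltnNge leq_pmull //=.
case: ltnP => // le_kn; case: eqP => // eq_kn; move: ndvd.
by rewrite (_ : n = k.+1) ?dvdnn //; lia.
Qed.

Lemma fdil_cong N f g : cong (qq ^+ N) f g -> cong (qq ^+ N) (fdil k.+1 f) (fdil k.+1 g).
Proof.
move=> /congqP fg; apply/congqP => m lt_mN; rewrite /= /ps_dil; case: ifP => // _.
by rewrite fg // (leq_ltn_trans (leq_div _ _)).
Qed.

End Dilation.

Definition ofpoly (p : {poly int}) := Fps (fun n => p`_n).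

Fact ofpoly_zmod : zmod_morphism ofpoly.
Proof. by move=> p r; apply: fpsP => n; rewrite /= coefB. Qed.
Fact ofpoly_monoid : monoid_morphism ofpoly.
Proof.
split=> [|p r]; apply: fpsP => n; first by rewrite cf1 /= coef1.
by rewrite /= coefM.
Qed.
HB.instance Definition _ := GRing.isZmodMorphism.Build _ _ ofpoly ofpoly_zmod.
HB.instance Definition _ := GRing.isMonoidMorphism.Build _ _ ofpoly ofpoly_monoid.

Lemma ofpolyX : ofpoly 'X = qq.
Proof. by apply: fpsP => n; rewrite /= coefX. Qed.

Definition etaq k := fdil k (Fps E).

Lemma eta_cong k N M : (N <= M)%N -> cong (qq ^+ N) (etaq k.+1) (poch (qq ^+ k.+1) M).
Proof.
move=> le_NM; have -> : poch (qq ^+ k.+1) M = fdil k.+1 (poch qq M).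
  rewrite rmorph_prod; apply: eq_bigr => i _.
  by rewrite rmorphB rmorph1 rmorphXn /= fdil_qq.
apply/fdil_cong/congqP => m lt_mN.
transitivity (cf (poch qq m) m).
  rewrite /= /E big_add1 big_mkord -[LHS]/(cf (ofpoly _) m) rmorph_prod.
  congr (cf _ m); apply: eq_bigr => i _.
  by rewrite rmorphB rmorph1 rmorphXn; congr (1 - _ ^+ _); exact: ofpolyX.
have /congqP/(_ m (leqnn _)) // : cong (qq ^+ m.+1) (poch qq m) (poch qq M).
by apply/cong_sym/poch_cong; apply: leq_trans (ltnW lt_mN) _.
Qed.

(** A convergent infinite product with a uniform rate: equality of two products then follows from
    equality of their factors at each index. *)
Definition is_prod f (F : nat -> fps) := forall N, cong (qq ^+ N) f (\prod_(i < N) F i).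

Lemma is_prodM f g F G : is_prod f F -> is_prod g G -> is_prod (f * g) (fun i => F i * G i).
Proof. by move=> fF gG N; rewrite big_split; apply: congM. Qed.

Lemma is_prodX n f F : is_prod f F -> is_prod (f ^+ n) (fun i => F i ^+ n).
Proof. by move=> fF N; rewrite prodrXl; apply: congX. Qed.

Lemma is_prod_eq f g F G : is_prod f F -> is_prod g G -> F =1 G -> f = g.
Proof.
move=> fF gG FG; apply: congq_eq => N; apply: cong_trans (fF N) _.
by under eq_bigr do rewrite FG; apply: cong_sym.
Qed.

Section EtaProducts.
Variable k : nat.
Let t := qq ^+ k.+1.
Let e m := etaq (k.+1 * m).

Lemma tq n : cong qq (t ^+ n.+1) 0.
Proof. by exists (qq ^+ k * t ^+ n); rewrite subr0 exprS /t exprS; ring. Qed.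

Lemma is_prod_eta m c : is_prod (e m.+1)
  (fun i => \prod_(r < c.+1) (1 - (t ^+ i) ^+ (m.+1 * c.+1) * t ^+ (m.+1 * r.+1))).
Proof.
move=> N; have -> : e m.+1 = etaq (k.+1 * m.+1).-1.+1 by [].
apply: cong_trans (@eta_cong _ N (c.+1 * N) _) _; first by rewrite leq_pmull.
rewrite (_ : (k.+1 * m.+1).-1.+1 = (k.+1 * m.+1)%N) // exprM -/t /poch.
rewrite (_ : \prod_(i < c.+1 * N) _ = \prod_(i < N)
  \prod_(r < c.+1) (1 - (t ^+ i) ^+ (m.+1 * c.+1) * t ^+ (m.+1 * r.+1))) //.
elim: (N) => [|M IH]; first by rewrite muln0 !big_ord0.
rewrite mulnS addnC big_split_ord /= IH [in RHS]big_ord_recr /=; congr (_ * _).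
by apply: eq_bigr => r _; rewrite -!exprM -exprD; congr (1 - _ ^+ _); lia.
Qed.

Lemma is_prod_jac a b n : a * b = t ^+ n.+1 -> is_prod (jac a b)
  (fun i => (1 + a * (t ^+ i) ^+ n.+1) * (1 + b * (t ^+ i) ^+ n.+1)
             * (1 - t ^+ n.+1 * (t ^+ i) ^+ n.+1)).
Proof.
move=> abt N; have q_ab : cong qq (a * b) 0 by rewrite abt; apply: tq.
rewrite (_ : \prod_(i < N) _ = jac_prod a b N); first exact: jac_cong.
by apply: eq_bigr => i _; rewrite abt [_ ^+ i.+1]exprS !(exprAC t n.+1).
Qed.

Lemma jac_1_5 : jac (- t) (- t ^+ 5) * e 2 * e 3 = e 1 * e 6 ^+ 2.
Proof.
have J := @is_prod_jac (- t) (- t ^+ 5) 5 ltac:(ring).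
apply: (is_prod_eq (is_prodM (is_prodM J (is_prod_eta 1 2)) (is_prod_eta 2 1))
  (is_prodM (is_prod_eta 0 5) (is_prodX 2 (is_prod_eta 5 0)))) => i.
by rewrite !big_ord_recl !big_ord0 /bump; ring.
Qed.

Lemma jac_1_1 : jac t t * e 1 ^+ 2 * e 4 ^+ 2 = e 2 ^+ 5.
Proof.
have J := @is_prod_jac t t 1 ltac:(ring).
(* The two parts are cut into blocks of different lengths: three copies match factors in
   [t^2 (t^i)^2], two copies match [(1 - t (t^i)^2) (1 + t (t^i)^2)] and [e 4]. *)
have -> : e 2 ^+ 5 = e 2 ^+ 3 * e 2 ^+ 2 by rewrite -exprD.
apply: (is_prod_eq
  (is_prodM (is_prodM J (is_prodX 2 (is_prod_eta 0 1))) (is_prodX 2 (is_prod_eta 3 0)))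
  (is_prodM (is_prodX 3 (is_prod_eta 1 0)) (is_prodX 2 (is_prod_eta 1 1)))) => i.
by rewrite !big_ord_recl !big_ord0 /bump; ring.
Qed.

Lemma jac_1_1_neg : jac (- t) (- t) * e 2 = e 1 ^+ 2.
Proof.
have J := @is_prod_jac (- t) (- t) 1 ltac:(ring).
apply: (is_prod_eq (is_prodM J (is_prod_eta 1 0)) (is_prodX 2 (is_prod_eta 0 1))) => i.
by rewrite !big_ord_recl !big_ord0 /bump; ring.
Qed.

Lemma jac_1_2 : jac (- t) (- t ^+ 2) = e 1.
Proof.
have J := @is_prod_jac (- t) (- t ^+ 2) 2 ltac:(ring).
apply: (is_prod_eq J (is_prod_eta 0 2)) => i.
by rewrite !big_ord_recl !big_ord0 /bump; ring.
Qed.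

(** This series is [2 psi(t)]. The factors do not match index by index: the product of the [1 + t^i]
    starts at [i = 0] with the factor [2], and has to be shifted by one. The shift costs [1 + t^N],
    which is [1] modulo [qq ^+ N]. *)
Lemma jac_1_0 : jac t 1 * e 1 = 2 * e 2 ^+ 2.
Proof.
have J := @is_prod_jac t 1 0 ltac:(ring).
have H := is_prodM J (is_prod_eta 0 0).
have H2 := is_prodX 2 (is_prod_eta 1 0).
apply: congq_eq => N; apply: cong_trans (H N) _.
apply: cong_trans (cong_sym (congM (cong_refl _ 2) (H2 N))).
pose A (j : nat) := \prod_(i < N) (1 + t ^+ (i + j)).
have shift : (1 + t ^+ N) * A 0 = 2 * A 1.
  rewrite /A; elim: (N) => [|M IH]; first by rewrite !big_ord0; ring.
  rewrite !big_ord_recr /= addn0 addn1.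
  transitivity ((1 + t ^+ M.+1) * ((1 + t ^+ M) * \prod_(i < M) (1 + t ^+ (i + 0)))).
    by ring.
  by rewrite IH; ring.
have N1 : cong (qq ^+ N) (1 + t ^+ N) 1.
  rewrite -[X in cong _ _ X]addr0; apply: congD => //.
  by apply: (cong_exp_base (tq 0)); rewrite expr1; exists 1; ring.
apply: (@cong_trans _ _ (A 0 * (\prod_(i < N) ((1 + t ^+ i.+1) * (1 - t ^+ i.+1) ^+ 2)))).
  rewrite /A -big_split /= (eq_bigr (fun i : 'I_N => (1 + t ^+ (i + 0)) *
    ((1 + t ^+ i.+1) * (1 - t ^+ i.+1) ^+ 2))) // => i _.
  by rewrite !big_ord_recl !big_ord0 addn0 ![t ^+ i.+1]exprS; move: (t ^+ i) => w; ring.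
apply: (@cong_trans _ _ ((1 + t ^+ N) * A 0 *
    (\prod_(i < N) ((1 + t ^+ i.+1) * (1 - t ^+ i.+1) ^+ 2)))).
  by apply: congM => //; rewrite -[X in cong _ X _]mul1r; apply: congM => //; apply: cong_sym.
rewrite shift -mulrA -big_split /=; apply: congM => //.
rewrite [X in cong _ X _](_ : _ = \prod_(i < N)
  (\prod_(r < 1) (1 - t ^+ i ^+ (2 * 1) * t ^+ (2 * r.+1))) ^+ 2) //.
apply: eq_bigr => i _.
by rewrite !big_ord_recl !big_ord0 addn1 ![t ^+ i.+1]exprS; move: (t ^+ i) => w; ring.
Qed.

Lemma jac_1_5_neg : jac t (t ^+ 5) * e 1 * e 4 * e 6 = e 2 ^+ 2 * e 3 * e 12.
Proof.
have J := @is_prod_jac t (t ^+ 5) 5 ltac:(ring).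
have -> : e 2 ^+ 2 = e 2 * e 2 by rewrite expr2.
apply: (is_prod_eq
  (is_prodM (is_prodM (is_prodM J (is_prod_eta 0 5)) (is_prod_eta 3 2)) (is_prod_eta 5 1))
  (is_prodM (is_prodM (is_prodM (is_prod_eta 1 5) (is_prod_eta 1 2)) (is_prod_eta 2 1))
    (is_prod_eta 11 0))) => i.
rewrite !big_ord_recl !big_ord0 /bump.
by ring.
Qed.

End EtaProducts.

(** * Modular equations *)

Lemma jacC a b : jac a b = jac b a.
Proof.
congr flim; apply/funext => N; apply: eq_bigr => i _.
by rewrite (mulrC b a) [X in X * _ = _]mulrC.
Qed.

Lemma cong_qq f : cong qq (qq * f) 0.
Proof. by exists f; rewrite subr0. Qed.

Lemma cong_qqX k : cong qq (qq ^+ k.+1) 0.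
Proof. by rewrite exprS; apply: cong_qq. Qed.

Lemma etaq_const k : cf (etaq k) 0 = 1.
Proof. by rewrite /= /ps_dil dvdn0 div0n /E big_geq // coef1. Qed.

Lemma etaq_unit k : etaq k \is a GRing.unit.
Proof. by apply: fps_unit; apply: etaq_const. Qed.

Lemma etaq_neq0 k : etaq k != 0.
Proof. by apply: contraTneq (etaq_unit k) => ->; rewrite unitr0. Qed.

(** * Jacobi's quartic identity *)

Section QuarticAlgebra.
Variables (F : fieldType) (t e1 e2 e4 e8 P M A B : F).
Hypotheses (n1 : e1 != 0) (n2 : e2 != 0) (n4 : e4 != 0) (n8 : e8 != 0).
Hypotheses (hP : P * e1 ^+ 2 * e4 ^+ 2 = e2 ^+ 5) (hM : M * e2 = e1 ^+ 2).
Hypotheses (hA : A * e2 ^+ 2 * e8 ^+ 2 = e4 ^+ 5) (hB : B * e4 = 2 * e8 ^+ 2).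
Hypotheses (sum : P ^+ 2 = A ^+ 2 + t * B ^+ 2) (dif : M ^+ 2 = A ^+ 2 - t * B ^+ 2).

(** Here [P], [M], [A], [B] stand for [phi(t)], [phi(-t)], [phi(t^2)] and [2 psi(t^4)]. Squaring
    [sum] and [dif] gives [P^4 - M^4 = 4 t A^2 B^2], in which [e8] cancels. *)
Lemma quartic_algebra :
  e2 ^+ 24 = e1 ^+ 16 * e4 ^+ 8 + 16 * t * e1 ^+ 8 * e4 ^+ 16.
Proof.
have EP : P = e2 ^+ 5 / (e1 ^+ 2 * e4 ^+ 2) by rewrite -hP; field; rewrite n1 n4.
have EM : M = e1 ^+ 2 / e2 by rewrite -hM; field.
have EA : A = e4 ^+ 5 / (e2 ^+ 2 * e8 ^+ 2) by rewrite -hA; field; rewrite n2 n8.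
have EB : B = 2 * e8 ^+ 2 / e4 by rewrite -hB; field.
have H : (P ^+ 2) ^+ 2 = (M ^+ 2) ^+ 2 + 4 * t * A ^+ 2 * B ^+ 2 by rewrite sum dif; ring.
transitivity ((P ^+ 2) ^+ 2 * e1 ^+ 8 * e2 ^+ 4 * e4 ^+ 8).
  by rewrite EP; field; rewrite n1 n4.
by rewrite H EM EA EB; field; rewrite n2 n4 n8.
Qed.
End QuarticAlgebra.

Section QuarticDomain.
Variables (R : idomainType) (t e1 e2 e4 e8 P M A B : R).
Hypotheses (n1 : e1 != 0) (n2 : e2 != 0) (n4 : e4 != 0) (n8 : e8 != 0).
Hypotheses (hP : P * e1 ^+ 2 * e4 ^+ 2 = e2 ^+ 5) (hM : M * e2 = e1 ^+ 2).
Hypotheses (hA : A * e2 ^+ 2 * e8 ^+ 2 = e4 ^+ 5) (hB : B * e4 = 2 * e8 ^+ 2).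
Hypotheses (sum : P ^+ 2 = A ^+ 2 + t * B ^+ 2) (dif : M ^+ 2 = A ^+ 2 - t * B ^+ 2).

Let toF := (@tofrac R : {rmorphism R -> {fraction R}}).

(** Power series form only an integral domain, so the quotients are taken in its fraction field and
    the polynomial conclusion is pulled back. *)
Lemma quartic_domain :
  e2 ^+ 24 = e1 ^+ 16 * e4 ^+ 8 + 16 * t * e1 ^+ 8 * e4 ^+ 16.
Proof.
apply/eqP; rewrite -tofrac_eq; apply/eqP; rewrite -/toF.
have pP := congr1 toF hP; have pM := congr1 toF hM; have pA := congr1 toF hA.
have pB := congr1 toF hB; have pS := congr1 toF sum; have pD := congr1 toF dif.
rewrite !(rmorphB, rmorphD, rmorphM, rmorphXn, rmorph_nat) in pP pM pA pB pS pD *.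
have nz (x : R) : x != 0 -> toF x != 0 by rewrite tofrac_eq0.
exact: (quartic_algebra (nz _ n1) (nz _ n2) (nz _ n4) (nz _ n8) pP pM pA pB pS pD).
Qed.
End QuarticDomain.

(** The dissection with [g = 1] and [a = t], then [a = - t], yields the two hypotheses on [P ^+ 2]
    and [M ^+ 2]. *)
Lemma quartic k : let e m := etaq (k.+1 * m) in
  e 2 ^+ 24 = e 1 ^+ 16 * e 4 ^+ 8 + 16 * qq ^+ k.+1 * e 1 ^+ 8 * e 4 ^+ 16.
Proof.
move=> e; set t := qq ^+ k.+1; have t0 : t != 0 by rewrite expf_neq0 ?qq_neq0.
have tq1 : cong qq (t * 1) 0 by rewrite mulr1; apply: cong_qqX.
have tq1N : cong qq (- t * 1) 0.
  by exists (- qq ^+ k); rewrite subr0 mulr1 mulrN -exprS.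
have S := jac_dissection tq1 t0 (oner_neq0 _).
have D := jac_dissection tq1N (_ : - t != 0) (oner_neq0 _).
rewrite !expr1n !mulr1 !sqrrN in S D; rewrite oppr_eq0 in D; have {}D := D t0.
rewrite (_ : (- t) ^+ 4 = t ^+ 4) in D; last by ring.
have hP := jac_1_1 k; have hM := jac_1_1_neg k.
have hA := jac_1_1 (k.+1 * 2).-1; have hB := jac_1_0 (k.+1 * 4).-1.
rewrite !prednK ?muln_gt0 // -/t in hP hM hA hB.
rewrite -!mulnA !exprM -/t in hA hB.
apply: (quartic_domain (e8 := e 8) (P := jac t t) (M := jac (- t) (- t))
  (A := jac (t ^+ 2) (t ^+ 2)) (B := jac (t ^+ 4) 1)); rewrite ?etaq_neq0 //.
by rewrite expr2 D mulNr.
Qed.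

(** * The quotient [la], and [xi] in terms of [X] and [s] *)

Section LambdaAlgebra.
Variables (F : fieldType) (q e1 e2 e3 e4 e6 e12 A B C D G : F).
Hypotheses (n1 : e1 != 0) (n2 : e2 != 0) (n3 : e3 != 0) (n4 : e4 != 0)
  (n6 : e6 != 0) (n12 : e12 != 0).
Hypotheses (hA : A * e2 * e3 = e1 * e6 ^+ 2) (hB : B * e1 * e4 * e6 = e2 ^+ 2 * e3 * e12).
Hypotheses (hC : C * e3 ^+ 2 * e12 ^+ 2 = e6 ^+ 5) (hD : D * e6 = e3 ^+ 2).
Hypotheses (hG : G * e4 * e6 = e2 * e12 ^+ 2).
Hypotheses (dis : A * C = e4 ^+ 2 - q * G ^+ 2) (disN : B * D = e4 ^+ 2 + q * G ^+ 2).
Hypotheses (quart1 : e2 ^+ 24 = e1 ^+ 16 * e4 ^+ 8 + 16 * q * e1 ^+ 8 * e4 ^+ 16)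
  (quart3 : e6 ^+ 24 = e3 ^+ 16 * e12 ^+ 8 + 16 * q ^+ 3 * e3 ^+ 8 * e12 ^+ 16).

Variable la : F.
Hypothesis laD : la = e2 * e4 ^+ 2 * e12 ^+ 2 * e3 ^+ 3 / (e1 * e6 ^+ 7).
Variable X : F.
Hypothesis XD : X = e4 ^+ 5 * e12 / (e2 * e6 ^+ 5).
(** This is [q G^2 / e4^2], so the two dissections say [1 - be = A C / e4^2] and
    [1 + be = B D / e4^2]. Both are therefore eta quotients, and everything below is written in
    terms of [be]: [la = 1 / (1 - be)], [X = 1 / (1 - be^2)], [s = X be]. *)
Variable be : F.
Hypothesis beD : be = q * e2 ^+ 2 * e12 ^+ 4 / (e4 ^+ 4 * e6 ^+ 2).
Variable nu : F.
Hypothesis nuD : nu = e1 ^+ 2 * e2 * e3 ^+ 2 * e12 ^+ 3 / (e4 * e6 ^+ 7).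
Variable M : F.
Hypothesis MD : M = e2 ^+ 10 * e3 ^+ 4 * e12 ^+ 4 / (e1 ^+ 4 * e4 ^+ 4 * e6 ^+ 10).

Let EG : G = e2 * e12 ^+ 2 / (e4 * e6).
Proof. by rewrite -hG; field; rewrite n4 n6. Qed.

Let beM : 1 - be = e1 * e6 ^+ 7 / (e2 * e3 ^+ 3 * e12 ^+ 2 * e4 ^+ 2).
Proof.
have EA : A = e1 * e6 ^+ 2 / (e2 * e3) by rewrite -hA; field; rewrite n2 n3.
have EC : C = e6 ^+ 5 / (e3 ^+ 2 * e12 ^+ 2) by rewrite -hC; field; rewrite n3 n12.
transitivity ((e4 ^+ 2 - q * G ^+ 2) / e4 ^+ 2).
  by rewrite EG beD; field; rewrite n4 n6.
by rewrite -dis EA EC; field; rewrite n2 n3 n4 n12.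
Qed.

Let beP : 1 + be = e2 ^+ 2 * e3 ^+ 3 * e12 / (e1 * e4 ^+ 3 * e6 ^+ 2).
Proof.
have EB : B = e2 ^+ 2 * e3 * e12 / (e1 * e4 * e6) by rewrite -hB; field; rewrite n1 n4 n6.
have ED : D = e3 ^+ 2 / e6 by rewrite -hD; field.
transitivity ((e4 ^+ 2 + q * G ^+ 2) / e4 ^+ 2).
  by rewrite EG beD; field; rewrite n4 n6.
by rewrite -disN EB ED; field; rewrite n1 n4 n6.
Qed.

Let beM0 : 1 - be != 0.
Proof. by rewrite beM !mulf_neq0 ?invr_eq0 ?mulf_neq0 ?expf_neq0. Qed.
Let beP0 : 1 + be != 0.
Proof. by rewrite beP !mulf_neq0 ?invr_eq0 ?mulf_neq0 ?expf_neq0. Qed.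

Let laE : la = (1 - be)^-1.
Proof. by rewrite beM laD; field; rewrite n1 n2 n3 n4 n6 n12. Qed.
Let XE : X = ((1 - be) * (1 + be))^-1.
Proof. by rewrite beM beP XD; field; rewrite n1 n2 n3 n4 n6 n12. Qed.

Lemma lambda_sub1 : la - 1 = q * e2 ^+ 3 * e3 ^+ 3 * e12 ^+ 6 / (e1 * e4 ^+ 2 * e6 ^+ 9).
Proof.
have -> : la - 1 = la * be by rewrite laE; field.
by rewrite laD beD; field; rewrite n1 n4 n6.
Qed.

Lemma lambda_double_sub1 : 2 * la - 1 = e2 ^+ 3 * e12 ^+ 3 * e3 ^+ 6 / (e1 ^+ 2 * e4 * e6 ^+ 9).
Proof.
have -> : 2 * la - 1 = la * (1 + be) by rewrite laE; field.
by rewrite beP laD; field; rewrite n1 n4 n6.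
Qed.

(** The quartic identity at [q], scaled by [M^3 / e2^24]: as eta quotients, its two right-hand terms
    are monomials in [la - 1], [la], [2 la - 1] and [nu]. *)
Lemma modular1 : M ^+ 3 = 16 * (la - 1) * la ^+ 3 + (2 * la - 1) * nu ^+ 3.
Proof.
transitivity (M ^+ 3 / e2 ^+ 24 * (e1 ^+ 16 * e4 ^+ 8 + 16 * q * e1 ^+ 8 * e4 ^+ 16)).
  by rewrite -quart1 divfK ?expf_neq0.
rewrite lambda_sub1 lambda_double_sub1 MD laD nuD; field.
by rewrite n1 n2 n4 n6.
Qed.

(** The same for the quartic identity at [q^3], scaled by [M / e6^24]. *)
Lemma modular3 : M = 16 * (la - 1) ^+ 3 * la + (2 * la - 1) ^+ 3 * nu.
Proof.
transitivity (M / e6 ^+ 24 * (e3 ^+ 16 * e12 ^+ 8 + 16 * q ^+ 3 * e3 ^+ 8 * e12 ^+ 16)).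
  by rewrite -quart3 divfK ?expf_neq0.
rewrite lambda_sub1 lambda_double_sub1 MD laD nuD; field.
by rewrite n1 n4 n6.
Qed.

Variable B2 : F.
Hypothesis B2D : B2 = e2 * e4 * e12 ^+ 5 / e6 ^+ 7.
Variable xi : F.
Hypothesis xiD : xi = e2 ^+ 5 * e6 / (e1 * e3 ^+ 5).

Lemma lambda_dissection : la = X + q * B2.
Proof.
have -> : q * B2 = X * be by rewrite B2D XD beD; field; rewrite n2 n4 n6.
by rewrite laE XE; field; rewrite beP0 beM0.
Qed.

Lemma lambda_odd_sqr : (q * B2) ^+ 2 = X ^+ 2 - X.
Proof.
have -> : q * B2 = X * be by rewrite B2D XD beD; field; rewrite n2 n4 n6.
by rewrite XE; field; rewrite beP0 beM0.
Qed.

(** Inserting [nu = 3 - 2 la] into [modular3] collapses [M] to [4 la - 3], and comparing eta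
    quotients gives [xi = la M / (2 la - 1)^2]. Thus [xi] is rational in [be]. *)
Lemma xi_lambda : nu = 3 - 2 * la -> xi = 2 * X + (3 - 4 * X) * (X - q * B2).
Proof.
move=> nuE; have ME : M = 4 * la - 3 by rewrite modular3 nuE; ring.
have -> : xi = la * M / (2 * la - 1) ^+ 2.
  rewrite lambda_double_sub1 laD MD xiD; field.
  by rewrite n1 n2 n3 n4 n6 n12.
have -> : q * B2 = X * be by rewrite B2D XD beD; field; rewrite n2 n4 n6.
have d : 2 * la - 1 = (1 + be) / (1 - be) by rewrite laE; field.
by rewrite ME d laE XE; field; rewrite beP0 beM0.
Qed.

End LambdaAlgebra.

(* With nu = 3 - 2 la + d, eliminating M leaves d * (la - 1) * G = 0 where G has
   constant term 48. *)
Lemma nu_lambda (R : idomainType) (f : {rmorphism R -> int}) (la nu M : R) :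
  f la = 1 -> f nu = 1 -> la - 1 != 0 ->
  M ^+ 3 = 16 * (la - 1) * la ^+ 3 + (2 * la - 1) * nu ^+ 3 ->
  M = 16 * (la - 1) ^+ 3 * la + (2 * la - 1) ^+ 3 * nu -> nu = 3 - 2 * la.
Proof.
move=> la1 nu1 laN1 E3 E1; have [t tE] : exists t, t = la - 1 by exists (la - 1).
have [d dE] : exists d, d = nu - (3 - 2 * la) by exists (nu - (3 - 2 * la)).
have t0 : f t = 0 by rewrite tE !(rmorphB, rmorph1) la1.
have d0 : f d = 0 by rewrite dE !(rmorphB, rmorphM, rmorph_nat) la1 nu1.
(* The difference of the two sides is a cubic in [d] without constant term. As [u] is [1] modulo
   [t], its other coefficients are divisible by [t], and [t * G] is the cubic divided by [d]. Here
   [w] is [(u^5 - 1) / t]. *)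
pose u := 1 + 2 * t; pose w := 10 + 40 * t + 80 * t ^+ 2 + 80 * t ^+ 3 + 32 * t ^+ 4.
pose G := 24 * u * (1 + t) * (2 + 4 * t + 8 * t ^+ 2) + 3 * d * u * (w + 6 + 4 * t * w)
  + 2 * d ^+ 2 * u * (1 + u + u ^+ 2 + u ^+ 3 + u ^+ 4 + u ^+ 5 + u ^+ 6 + u ^+ 7).
have dtG : d * (t * G) = 0.
  move: E3; rewrite E1 => /eqP; rewrite -subr_eq0 => /eqP <-.
  have -> : nu = d + (3 - 2 * la) by rewrite dE subrK.
  by rewrite /G /w /u; have -> : la = 1 + t by [rewrite tE; ring]; ring.
have fG : f G = 48.
  by rewrite /G /w /u !(rmorphD, rmorphM, rmorphXn, rmorph_nat, rmorph1) t0 d0.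
have G0 : G != 0 by apply/eqP => e; move: fG; rewrite e rmorph0.
by move/eqP: dtG; rewrite !mulf_eq0 tE (negPf laN1) (negPf G0) !orbF dE subr_eq0 => /eqP.
Qed.

Section LambdaDomain.
Variables (R : idomainType) (q e1 e2 e3 e4 e6 e12 A B C D G la X nu M B2 xi : R).
Hypotheses (n1 : e1 != 0) (n2 : e2 != 0) (n3 : e3 != 0) (n4 : e4 != 0)
  (n6 : e6 != 0) (n12 : e12 != 0).
Hypotheses (hA : A * e2 * e3 = e1 * e6 ^+ 2) (hB : B * e1 * e4 * e6 = e2 ^+ 2 * e3 * e12).
Hypotheses (hC : C * e3 ^+ 2 * e12 ^+ 2 = e6 ^+ 5) (hD : D * e6 = e3 ^+ 2).
Hypotheses (hG : G * e4 * e6 = e2 * e12 ^+ 2).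
Hypotheses (dis : A * C = e4 ^+ 2 - q * G ^+ 2) (disN : B * D = e4 ^+ 2 + q * G ^+ 2).
Hypotheses (quart1 : e2 ^+ 24 = e1 ^+ 16 * e4 ^+ 8 + 16 * q * e1 ^+ 8 * e4 ^+ 16)
  (quart3 : e6 ^+ 24 = e3 ^+ 16 * e12 ^+ 8 + 16 * q ^+ 3 * e3 ^+ 8 * e12 ^+ 16).
Hypotheses (hla : la * (e1 * e6 ^+ 7) = e2 * e4 ^+ 2 * e12 ^+ 2 * e3 ^+ 3)
  (hX : X * (e2 * e6 ^+ 5) = e4 ^+ 5 * e12)
  (hnu : nu * (e4 * e6 ^+ 7) = e1 ^+ 2 * e2 * e3 ^+ 2 * e12 ^+ 3)
  (hM : M * (e1 ^+ 4 * e4 ^+ 4 * e6 ^+ 10) = e2 ^+ 10 * e3 ^+ 4 * e12 ^+ 4)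
  (hB2 : B2 * e6 ^+ 7 = e2 * e4 * e12 ^+ 5)
  (hxi : xi * (e1 * e3 ^+ 5) = e2 ^+ 5 * e6).

Let f := (@tofrac R : {rmorphism R -> {fraction R}}).

Let f_inj (x y : R) : f x = f y -> x = y.
Proof. by move=> /eqP; rewrite tofrac_eq => /eqP. Qed.

Let f_neq0 x : x != 0 -> f x != 0.
Proof. by rewrite tofrac_eq0. Qed.

Let fE := (rmorphB f, rmorphD f, rmorphM f, rmorphXn f, rmorph_nat f, rmorph1 f).

Let div_of (x y z : R) : y != 0 -> x * y = z -> f x = f z / f y.
Proof. by move=> y0 <-; rewrite rmorphM mulfK // f_neq0. Qed.

Lemma lambda_domain :
  [/\ (la - 1) * (e1 * e4 ^+ 2 * e6 ^+ 9) = q * e2 ^+ 3 * e3 ^+ 3 * e12 ^+ 6,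
      M ^+ 3 = 16 * (la - 1) * la ^+ 3 + (2 * la - 1) * nu ^+ 3 &
      M = 16 * (la - 1) ^+ 3 * la + (2 * la - 1) ^+ 3 * nu] /\
  [/\ la = X + q * B2, (q * B2) ^+ 2 = X ^+ 2 - X &
      nu = 3 - 2 * la -> xi = 2 * X + (3 - 4 * X) * (X - q * B2)].
Proof.
have [[m1 m2] m3] := (f_neq0 n1, f_neq0 n2, f_neq0 n3).
have [[m4 m6] m12] := (f_neq0 n4, f_neq0 n6, f_neq0 n12).
have pA := congr1 f hA; have pB := congr1 f hB; have pC := congr1 f hC.
have pD := congr1 f hD; have pG := congr1 f hG; have p1 := congr1 f dis.
have p2 := congr1 f disN; have p3 := congr1 f quart1; have p4 := congr1 f quart3.
rewrite !fE in pA pB pC pD pG p1 p2 p3 p4.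
have nX (x : R) n : x != 0 -> x ^+ n != 0 by exact: expf_neq0.
have dla := div_of (mulf_neq0 n1 (nX _ 7 n6)) hla.
have dX := div_of (mulf_neq0 n2 (nX _ 5 n6)) hX.
have dnu := div_of (mulf_neq0 n4 (nX _ 7 n6)) hnu.
have dM := div_of (mulf_neq0 (mulf_neq0 (nX _ 4 n1) (nX _ 4 n4)) (nX _ 10 n6)) hM.
have dB2 := div_of (nX _ 7 n6) hB2.
have dxi := div_of (mulf_neq0 n1 (nX _ 5 n3)) hxi.
rewrite !fE in dla dX dnu dM dB2 dxi.
set be := f q * f e2 ^+ 2 * f e12 ^+ 4 / (f e4 ^+ 4 * f e6 ^+ 2).
have L1 := lambda_sub1 m1 m2 m3 m4 m6 m12 pA pC pG p1 dla (erefl be).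
have L2 := modular1 m1 m2 m3 m4 m6 m12 pA pB pC pD pG p1 p2 p3 dla (erefl be) dnu dM.
have L3 := modular3 m1 m2 m3 m4 m6 m12 pA pB pC pD pG p1 p2 p4 dla (erefl be) dnu dM.
have L4 := lambda_dissection m1 m2 m3 m4 m6 m12 pA pB pC pD pG p1 p2 dla dX (erefl be) dB2.
have L5 := lambda_odd_sqr m1 m2 m3 m4 m6 m12 pA pB pC pD pG p1 p2 dX (erefl be) dB2.
have L6 := xi_lambda m1 m2 m3 m4 m6 m12 pA pB pC pD pG p1 p2 p4 dla dX (erefl be) dnu dM dB2 dxi.
split; split; try (apply: f_inj; rewrite !fE //).
- exact: (canLR (divfK (mulf_neq0 (mulf_neq0 m1 (expf_neq0 2 m4)) (expf_neq0 9 m6))) L1).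
- by move=> nuE; apply: f_inj; rewrite !fE; apply: L6; rewrite nuE !fE.
Qed.

Variable phi : {rmorphism R -> int}.
Hypotheses (v1 : phi e1 = 1) (v2 : phi e2 = 1) (v3 : phi e3 = 1) (v4 : phi e4 = 1)
  (v6 : phi e6 = 1) (v12 : phi e12 = 1) (q0 : q != 0).

Let vE := (rmorphM phi, rmorphXn phi, v1, v2, v3, v4, v6, v12, expr1n, mulr1).

(** The missing relation [nu = 3 - 2 la] comes from [nu_lambda], with [phi] the constant term; [la]
    differs from [1] because [la - 1] times a product of eta functions is a nonzero product. *)
Lemma lambda_key : [/\ la = X + q * B2, (q * B2) ^+ 2 = X ^+ 2 - X &
  xi = 2 * X + (3 - 4 * X) * (X - q * B2)].
Proof.
have [[H1 H2 H3] [H4 H5 H6]] := lambda_domain; split=> //; apply: H6.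
apply: (nu_lambda (f := phi)) H2 H3.
- by have := congr1 phi hla; rewrite !vE.
- by have := congr1 phi hnu; rewrite !vE.
apply/eqP => la0; move: H1; rewrite la0 mul0r => /esym/eqP.
by apply/negP; rewrite !mulf_neq0 ?expf_neq0.
Qed.

End LambdaDomain.

Lemma kappa_lambda (R : idomainType) (e1 e2 e3 e4 e6 e12 la ka g g2 : R) :
  e1 != 0 -> e2 != 0 -> e6 != 0 ->
  la * (e1 * e6 ^+ 7) = e2 * e4 ^+ 2 * e12 ^+ 2 * e3 ^+ 3 ->
  g * e3 ^+ 15 = e1 ^+ 5 * (e2 ^+ 5 * e6 ^+ 5) ->
  g2 * e6 ^+ 15 = e2 ^+ 5 * (e4 ^+ 5 * e12 ^+ 5) ->
  ka * g = g2 ^+ 2 -> ka = la ^+ 5.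
Proof.
move=> n1 n2 n6 hla hg hg2 hka.
have w0 : e1 ^+ 5 * (e2 ^+ 5 * e6 ^+ 5) * e6 ^+ 30 != 0.
  by rewrite !mulf_neq0 ?expf_neq0.
apply: (mulIf w0).
transitivity ((e2 ^+ 5 * (e4 ^+ 5 * e12 ^+ 5)) ^+ 2 * e3 ^+ 15).
  by rewrite -hg -hg2; transitivity (ka * g * e3 ^+ 15 * e6 ^+ 30); [ring | rewrite hka; ring].
transitivity ((e2 * e4 ^+ 2 * e12 ^+ 2 * e3 ^+ 3) ^+ 5 * e2 ^+ 5); first by ring.
by rewrite -hla; ring.
Qed.



Fact cf0_zmod : zmod_morphism (fun f : fps => cf f 0).
Proof. by []. Qed.
Fact cf0_monoid : monoid_morphism (fun f : fps => cf f 0).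
Proof. by split=> // f g; apply: cfM0. Qed.
Definition fconst (f : fps) : int := cf f 0.
HB.instance Definition _ := GRing.isZmodMorphism.Build fps int fconst cf0_zmod.
HB.instance Definition _ := GRing.isMonoidMorphism.Build fps int fconst cf0_monoid.

(** * Recurrences *)

Definition ev (R : comNzRingType) (x : R) : {rmorphism {poly int} -> R} :=
  horner_eval x \o map_poly intr.

Lemma evX (R : comNzRingType) (x : R) : ev x 'X = x.
Proof. by rewrite /= map_polyX /horner_eval hornerX. Qed.

Definition low_odd (d : nat) (P : {poly int}) :=
  exists2 Q : {poly int}, P = 'X^d * Q & odd (absz Q`_0).

Lemma oddzB (a b : int) : odd (absz (a - b)) = odd (absz a) (+) odd (absz b).
Proof. lia. Qed.

(** At degree [c + d] the first term contributes an even number, even when [c + d = a + d'], and the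
    second an odd one. *)
Lemma low_odd_step a c d d' (A C P P' : {poly int}) : ~~ odd (absz A`_0) ->
  odd (absz C`_0) -> low_odd d P -> low_odd d' P' -> (c + d <= a + d')%N ->
  low_odd (c + d) ('X^a * A * P' - 'X^c * C * P).
Proof.
move=> evA oddC [Q -> oddQ] [Q' -> _] le_e.
exists ('X^(a + d' - (c + d)) * A * Q' - C * Q).
  have -> : 'X^a * A * ('X^d' * Q') = 'X^(c + d) * ('X^(a + d' - (c + d)) * A * Q') :> {poly int}.
    by rewrite !mulrA -exprD subnKC // exprD; ring.
  by rewrite exprD; ring.
rewrite coefB oddzB !coef0M !abszM !oddM oddC oddQ (negPf evA).
by rewrite andbF.
Qed.

Section Recurrences.
Variables (R : comNzRingType) (D : {rmorphism R -> R}) (U : R -> R).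
Hypotheses (U_add : forall f g, U (f + g) = U f + U g) (U_one : U 1 = 1).
Hypothesis U_mul : forall f g, U (D f * g) = f * U g.
Variables (x s : R).
Hypotheses (s_sqr : s ^+ 2 = D x ^+ 2 - D x) (U_s : U s = 0).
Hypothesis x_dissection : x = 2 * D x + (3 - 4 * D x) * (D x - s).

Let Z i j := U ((D x + s) ^+ 5 ^+ i * x ^+ j).

Let evE := (rmorphB (ev x), rmorphD (ev x), rmorphM (ev x), rmorphXn (ev x), rmorph_nat (ev x),
  rmorph1 (ev x), evX x).
Let DE := (rmorphB D, rmorphD D, rmorphM D, rmorphXn D, rmorph_nat D, rmorph1 D).

Let U_normal f g : U (D f + D g * s) = f.
Proof. by rewrite U_add -[D f]mulr1 !U_mul U_one U_s mulr1 mulr0 addr0. Qed.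

Let U_lin2 a b f g h : h = D a * f - D b * g -> U h = a * U f - b * U g.
Proof. by move=> ->; rewrite -mulNr -rmorphN U_add !U_mul mulNr. Qed.

(** The coefficients are the trace and the norm of [x] under [s -> - s]. *)
Let xi_sqr : x ^+ 2 = D (10 * x - 8 * x ^+ 2) * x - D (9 * x - 8 * x ^+ 2) * 1.
Proof.
rewrite !DE; move: x_dissection s_sqr; move: (D x) => y -> s2.
have -> : (2 * y + (3 - 4 * y) * (y - s)) ^+ 2 = (2 * y + (3 - 4 * y) * y) ^+ 2
  - 2 * (2 * y + (3 - 4 * y) * y) * (3 - 4 * y) * s + (3 - 4 * y) ^+ 2 * s ^+ 2 by ring.
by rewrite s2; ring.
Qed.

Let kaE : (D x + s) ^+ 5 = D (16 * x ^+ 5 - 20 * x ^+ 4 + 5 * x ^+ 3)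
  + D (16 * x ^+ 4 - 12 * x ^+ 3 + x ^+ 2) * s.
Proof.
rewrite !DE; move: s_sqr; move: (D x) => y s2.
have -> : (y + s) ^+ 5 = y ^+ 5 + 10 * y ^+ 3 * s ^+ 2 + 5 * y * (s ^+ 2) ^+ 2
  + (5 * y ^+ 4 + 10 * y ^+ 2 * s ^+ 2 + (s ^+ 2) ^+ 2) * s by ring.
by rewrite s2; ring.
Qed.

(** Again trace and norm: the conjugates [D x + s] and [D x - s] have product [D x], so the norm of
    the fifth power is [D x ^+ 5]. *)
Let ka_sqr : (D x + s) ^+ 5 ^+ 2 =
  D (32 * x ^+ 5 - 40 * x ^+ 4 + 10 * x ^+ 3) * (D x + s) ^+ 5 - D (x ^+ 5) * 1.
Proof.
rewrite !DE; move: s_sqr; move: (D x) => y s2.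
have e1 : (y + s) * (y - s) = y by rewrite mulrC -subr_sqr s2; ring.
have e2 : (y + s) ^+ 5 + (y - s) ^+ 5 = 32 * y ^+ 5 - 40 * y ^+ 4 + 10 * y ^+ 3.
  have -> : (y + s) ^+ 5 + (y - s) ^+ 5 =
    2 * y ^+ 5 + 20 * y ^+ 3 * s ^+ 2 + 10 * y * (s ^+ 2) ^+ 2 by ring.
  by rewrite s2; ring.
transitivity (((y + s) ^+ 5 + (y - s) ^+ 5) * (y + s) ^+ 5 - ((y + s) * (y - s)) ^+ 5 * 1).
  by ring.
by rewrite e1 e2.
Qed.

Let xiE : x = D (5 * x - 4 * x ^+ 2) + D (4 * x - 3) * s.
Proof. by rewrite {1}x_dissection !DE; ring. Qed.

Let Z_j i j : Z i j.+2 =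
  ev x ('X^1 * (10 - 8 * 'X)) * Z i j.+1 - ev x ('X^1 * (9 - 8 * 'X)) * Z i j.
Proof.
have E : x ^+ j.+2 = x ^+ 2 * x ^+ j by rewrite -exprD.
apply: U_lin2; rewrite E xi_sqr !evE !DE (exprS x j); ring.
Qed.

Let Z_i i j : Z i.+2 j =
  ev x ('X^3 * (32 * 'X ^+ 2 - 40 * 'X + 10)) * Z i.+1 j - ev x ('X^5 * 1) * Z i j.
Proof.
have E : (D x + s) ^+ 5 ^+ i.+2 = (D x + s) ^+ 5 ^+ 2 * (D x + s) ^+ 5 ^+ i by rewrite -exprD.
apply: U_lin2; rewrite E ka_sqr !evE !DE; move: ((D x + s) ^+ 5) => w; rewrite (exprS w i); ring.
Qed.

Let good i j := exists2 P, low_odd (dij i j) P & Z i j = ev x P.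

Let Z00 : good 0 0.
Proof. by exists 1; [exists 1; rewrite ?mulr1 // coef1 | rewrite /Z mulr1 U_one evE]. Qed.

Let Z01 : good 0 1.
Proof.
exists ('X^1 * (5 - 4 * 'X)); first by exists (5 - 4 * 'X) => //; rewrite coefB !coefE.
rewrite /Z mul1r expr1 [X in U X]xiE U_normal !evE; ring.
Qed.

Let Z10 : good 1 0.
Proof.
exists ('X^3 * (5 - 20 * 'X + 16 * 'X ^+ 2)).
  by exists (5 - 20 * 'X + 16 * 'X ^+ 2) => //; rewrite !coefE.
rewrite /Z expr1 mulr1 kaE U_normal !evE; ring.
Qed.

Let Z11 : good 1 1.
Proof.
exists ('X^3 * (3 - 18 * 'X + 16 * 'X ^+ 2)).
  by exists (3 - 18 * 'X + 16 * 'X ^+ 2) => //; rewrite !coefE.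
(* The witness is the coefficient of [s] in the product of the normal forms [kaE] and [xiE]. *)
rewrite /Z !expr1 -[RHS](U_normal _ ((16 * x ^+ 5 - 20 * x ^+ 4 + 5 * x ^+ 3) * (4 * x - 3)
  + (16 * x ^+ 4 - 12 * x ^+ 3 + x ^+ 2) * (5 * x - 4 * x ^+ 2))); congr U.
rewrite kaE [X in _ * X = _]xiE !evE !DE; move: s_sqr; move: (D x) => y s2.
pose p := 16 * y ^+ 5 - 20 * y ^+ 4 + 5 * y ^+ 3; pose r := 16 * y ^+ 4 - 12 * y ^+ 3 + y ^+ 2.
transitivity (p * (5 * y - 4 * y ^+ 2) + r * (4 * y - 3) * s ^+ 2
  + (p * (4 * y - 3) + r * (5 * y - 4 * y ^+ 2)) * s); first by rewrite /p /r; ring.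
by rewrite s2 /p /r; ring.
Qed.

Lemma U_low_odd i j : exists2 P, low_odd (dij i j) P & U ((D x + s) ^+ 5 ^+ i * x ^+ j) = ev x P.
Proof.
rewrite -/(Z i j) -/(good i j).
have stepi k l : good k l -> good k.+1 l -> good k.+2 l.
  move=> [P oP ZP] [P' oP' ZP']; rewrite /good Z_i ZP ZP' -!rmorphM -rmorphB.
  exists ('X^3 * (32 * 'X ^+ 2 - 40 * 'X + 10) * P' - 'X^5 * 1 * P) => //.
  have -> : dij k.+2 l = (5 + dij k l)%N by rewrite /dij /= negbK; case: (odd k); case: (odd l); lia.
  apply: low_odd_step oP oP' _; rewrite ?coefE //.
  (* This says that [dij] grows by at least [2] from [k] to [k.+1]. Equality occurs, for instance
     from [(0, 1)] to [(1, 1)], and there the evenness of the coefficient [10] is decisive. *)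
  by rewrite /dij /= uphalf_half; case: (odd k); case: (odd l) => /=; lia.
have stepj k l : good k l -> good k l.+1 -> good k l.+2.
  move=> [P oP ZP] [P' oP' ZP']; rewrite /good Z_j ZP ZP' -!rmorphM -rmorphB.
  exists ('X^1 * (10 - 8 * 'X) * P' - 'X^1 * (9 - 8 * 'X) * P) => //.
  have -> : dij k l.+2 = (1 + dij k l)%N.
    by rewrite /dij /= negbK; case: (odd k); case: (odd l); lia.
  apply: low_odd_step oP oP' _; rewrite ?coefE //.
  by rewrite /dij /= uphalf_half; case: (odd k); case: (odd l) => /=; lia.
have two (G : nat -> Prop) : G 0%N -> G 1%N -> (forall n, G n -> G n.+1 -> G n.+2) -> forall n, G n.
  move=> G0 G1 step n; suff [] : G n /\ G n.+1 by [].
  by elim: n => [|n [Gn Gn1]]; split=> //; apply: step.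
(* First induct on [i] in the columns [j = 0] and [j = 1], then on [j] in each row. *)
by apply: (two (good i)) => [||l]; [apply: (two (good^~ 0%N)) | apply: (two (good^~ 1%N)) | apply: stepj] => // k; apply: stepi.
Qed.

End Recurrences.

(** * Uniqueness of the polynomial in [xi] *)

Section Transcendence.
Variables (R : idomainType) (phi : {rmorphism R -> int}) (x : R).
Hypotheses (x1 : phi x = 1) (xN1 : x - 1 != 0).

(** Taking constant terms in [P(x) = 0] gives [P(1) = 0]. Hence ['X - 1] divides [P]; as [x - 1] is
    not a zero divisor, the quotient also vanishes at [x], and its size is smaller. *)
Lemma ev_inj P : ev x P = 0 -> P = 0.
Proof.
have [n] := ubnP (size P); elim: n P => // n IH P; rewrite ltnS => leP evP.
have phi_ev Q : phi (ev x Q) = Q.[1].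
  rewrite /= /horner_eval -horner_map /= -map_poly_comp x1 map_poly_id // => c _.
  by rewrite /= rmorph_int intz.
have /factor_theorem[Q PE] : root P 1 by rewrite rootE -phi_ev evP rmorph0.
have evQ : ev x Q = 0.
  apply: (mulIf xN1); rewrite mul0r -evP PE polyC1 rmorphM rmorphB rmorph1.
  by rewrite evX.
have [Q0|Qn0] := eqVneq Q 0; first by rewrite PE Q0 mul0r.
rewrite PE (IH Q) ?mul0r //; move: leP.
by rewrite PE size_Mmonic ?monicXsubC // size_XsubC addn2.
Qed.

End Transcendence.

(** * The operator U and the main theorem *)

Definition fU (f : fps) := Fps (ps_U (cf f)).

Lemma fU_dilM f g : fU (fdil 2 f * g) = f * fU g.
Proof.
apply: fpsP => n; rewrite cfM -[LHS]/(cf (fdil 2 f * g) (2 * n)%N) cfM.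
have even_sum (F : nat -> int) : (forall k, F (2 * k).+1 = 0) ->
    \sum_(k < (2 * n).+1) F k = \sum_(k < n.+1) F (2 * k)%N.
  move=> F0; elim: (n) => [|m IH]; first by rewrite !big_ord_recl !big_ord0.
  rewrite mulnS big_ord_recr big_ord_recr [RHS]big_ord_recr /= -IH.
  by rewrite (_ : (2 * m).+1 = (1 + 2 * m)%N) // F0 addr0 mulnS.
rewrite (even_sum (fun k => cf (fdil 2 f) k * cf g (2 * n - k)%N)) => [|k].
  apply: eq_bigr => k _ /=.
  by rewrite /ps_dil /ps_U dvdn_mulr // mulKn // mulnBr.
by rewrite /= /ps_dil; case: ifP; rewrite ?mul0r // dvdn2; lia.
Qed.

Lemma fU_qq f : fU (qq * fdil 2 f) = 0.
Proof.
apply: fpsP => n; rewrite [LHS]/= /ps_U -[LHS]/(cf (qq * fdil 2 f) (2 * n)%N) cf_qqM.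
by case: n => // n; rewrite mulnS /= /ps_dil; case: ifP => //; rewrite dvdn2; lia.
Qed.

Lemma fdil_fdil j k f : fdil j.+1 (fdil k.+1 f) = fdil (j.+1 * k.+1) f.
Proof.
apply: fpsP => n; rewrite /= /ps_dil; case: ifP => [/dvdnP[m ->]|ndvd].
  by rewrite mulnK // (mulnC j.+1) dvdn_pmul2r // divnMr.
by case: ifP => // /(dvdn_trans (dvdn_mulr _ (dvdnn _))); rewrite ndvd.
Qed.

Lemma fdil_etaq j k : fdil j.+1 (etaq k.+1) = etaq (j.+1 * k.+1).
Proof. exact: fdil_fdil. Qed.

Lemma etaq1 : Fps E = etaq 1.
Proof. by apply: fpsP => n; rewrite /= /ps_dil dvd1n divn1. Qed.

Lemma fps_div (f g : fps) : cf g 0 = 1 -> exists h, h * g = f.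
Proof. by move=> /fps_unit ug; exists (f / g); rewrite divrK. Qed.

Lemma cfX0 f n : cf (f ^+ n) 0 = cf f 0 ^+ n.
Proof. exact: (rmorphXn fconst). Qed.

Lemma xiM : Fps xi * (etaq 1 * etaq 3 ^+ 5) = etaq 2 ^+ 5 * etaq 6.
Proof.
have -> : Fps xi = Fps (ps_pow (ps_dil 2 E) 5) * (Fps (ps_dil 6 E) *
  Fps (ps_inv (ps_mul E (ps_pow (ps_dil 3 E) 5)))) by [].
set d := etaq 1 * _; have dE : ps_mul E (ps_pow (ps_dil 3 E) 5) = cf d.
  by rewrite -[LHS]/(cf (Fps E * Fps (ps_pow (ps_dil 3 E) 5))) Fps_pow etaq1.
have d1 : cf d 0 = 1.
  by rewrite /d cfM0 cfX0 !etaq_const expr1n.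
have assoc (a b c : fps) : a * (b * c) * d = a * (b * (c * d)) by rewrite !mulrA.
by rewrite dE assoc ps_invK // mulr1 Fps_pow.
Qed.

Lemma gammaM : Fps gamma * etaq 3 ^+ 15 = etaq 1 ^+ 5 * (etaq 2 ^+ 5 * etaq 6 ^+ 5).
Proof.
have -> : Fps gamma = Fps (ps_pow E 5) * (Fps (ps_pow (ps_dil 2 E) 5) *
  (Fps (ps_pow (ps_dil 6 E) 5) * Fps (ps_inv (ps_pow (ps_dil 3 E) 15)))) by [].
set d := etaq 3 ^+ 15; have dE : ps_pow (ps_dil 3 E) 15 = cf d.
  by rewrite -[LHS]/(cf (Fps (ps_pow (ps_dil 3 E) 15))) Fps_pow.
have d1 : cf d 0 = 1 by rewrite /d cfX0 etaq_const expr1n.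
have assoc (a b c i : fps) : a * (b * (c * i)) * d = a * (b * (c * (i * d))).
  by rewrite !mulrA.
rewrite dE.
rewrite assoc.
rewrite (ps_invK d1) mulr1.
rewrite (Fps_pow E) etaq1.
rewrite (Fps_pow (ps_dil 2 E)).
rewrite (Fps_pow (ps_dil 6 E)).
by [].
Qed.

Lemma kappaM : Fps kappa * Fps gamma = fdil 2 (Fps gamma) ^+ 2.
Proof.
have -> : Fps kappa = Fps (ps_pow (ps_dil 2 gamma) 2) * Fps (ps_inv (cf (Fps gamma))) by [].
rewrite -mulrA ps_invK ?mulr1 ?Fps_pow //.
have := congr1 (fun f => cf f 0) gammaM; rewrite !(cfX0, cfM0) !etaq_const.
by rewrite !expr1n !mulr1.
Qed.

Lemma key_identities : exists la be : fps, cf be 0 = 1 /\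
  [/\ Fps kappa = la ^+ 5, la = fdil 2 (Fps xi) + qq * fdil 2 be,
      (qq * fdil 2 be) ^+ 2 = fdil 2 (Fps xi) ^+ 2 - fdil 2 (Fps xi) &
      Fps xi = 2 * fdil 2 (Fps xi)
        + (3 - 4 * fdil 2 (Fps xi)) * (fdil 2 (Fps xi) - qq * fdil 2 be)].
Proof.
have e1 k : cf (etaq k) 0 = 1 := etaq_const k.
have [la hla] : exists la, la * (etaq 1 * etaq 6 ^+ 7) =
    etaq 2 * etaq 4 ^+ 2 * etaq 12 ^+ 2 * etaq 3 ^+ 3.
  by apply: fps_div; rewrite cfM0 cfX0 !e1.
have [nu hnu] : exists nu, nu * (etaq 4 * etaq 6 ^+ 7) =
    etaq 1 ^+ 2 * etaq 2 * etaq 3 ^+ 2 * etaq 12 ^+ 3.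
  by apply: fps_div; rewrite cfM0 cfX0 !e1.
have [M hM] : exists M, M * (etaq 1 ^+ 4 * etaq 4 ^+ 4 * etaq 6 ^+ 10) =
    etaq 2 ^+ 10 * etaq 3 ^+ 4 * etaq 12 ^+ 4.
  by apply: fps_div; rewrite !(cfX0, cfM0) !e1.
(* Chosen so that [qq * fdil 2 be] is the odd part [s] of [la], which makes its oddness visible. *)
have [be hbe] : exists be, be * etaq 3 ^+ 7 = etaq 1 * etaq 2 * etaq 6 ^+ 5.
  by apply: fps_div; rewrite cfX0 e1 expr1n.
exists la, be.
have hX : fdil 2 (Fps xi) * (etaq 2 * etaq 6 ^+ 5) = etaq 4 ^+ 5 * etaq 12.
  have := congr1 (fdil 2) xiM.
  by rewrite !(rmorphXn (fdil 2), rmorphM (fdil 2)) /= !fdil_etaq.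
have hB : fdil 2 be * etaq 6 ^+ 7 = etaq 2 * etaq 4 * etaq 12 ^+ 5.
  have := congr1 (fdil 2) hbe.
  by rewrite !(rmorphXn (fdil 2), rmorphM (fdil 2)) /= !fdil_etaq.
have hg2 : fdil 2 (Fps gamma) * etaq 6 ^+ 15 = etaq 2 ^+ 5 * (etaq 4 ^+ 5 * etaq 12 ^+ 5).
  have := congr1 (fdil 2) gammaM.
  by rewrite !(rmorphXn (fdil 2), rmorphM (fdil 2)) /= !fdil_etaq.
have kaE := kappa_lambda (etaq_neq0 1) (etaq_neq0 2) (etaq_neq0 6) hla gammaM hg2 kappaM.
(* The dissection is applied with [g = - qq^2] and [a = - qq] or [a = qq]. It expands
   [f(-q, -q^5) f(q^3, q^3)] and [f(q, q^5) f(-q^3, -q^3)] in [f(-q^4, -q^8) = e_4] and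
   [f(-q^2, -q^10)]. *)
have qg : cong qq (qq * - qq ^+ 2) 0 by apply: cong_qq.
have qgN : cong qq (- qq * - qq ^+ 2) 0 by rewrite mulrNN; apply: cong_qq.
have g0 : - qq ^+ 2 != 0 by rewrite oppr_eq0 expf_neq0 ?qq_neq0.
have dis := jac_dissection qgN (_ : - qq != 0) g0; rewrite oppr_eq0 in dis.
have {}dis := dis qq_neq0; have disN := jac_dissection qg qq_neq0 g0.
have E1 : - qq * (- qq ^+ 2) ^+ 2 = - qq ^+ 5 by ring.
have E2 : - qq * - qq ^+ 2 = qq ^+ 3 by ring.
have E3 : (- qq) ^+ 2 * - qq ^+ 2 = - qq ^+ 4 by ring.
have E4 : (- qq) ^+ 2 * (- qq ^+ 2) ^+ 3 = - qq ^+ 4 ^+ 2 by ring.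
have E5 : (- qq) ^+ 4 * (- qq ^+ 2) ^+ 3 = - qq ^+ 2 ^+ 5 by ring.
have F1 : qq * (- qq ^+ 2) ^+ 2 = qq ^+ 5 by ring.
have F2 : qq * - qq ^+ 2 = - qq ^+ 3 by ring.
have F3 : qq ^+ 2 * - qq ^+ 2 = - qq ^+ 4 by ring.
have F4 : qq ^+ 2 * (- qq ^+ 2) ^+ 3 = - qq ^+ 4 ^+ 2 by ring.
have F5 : qq ^+ 4 * (- qq ^+ 2) ^+ 3 = - qq ^+ 2 ^+ 5 by ring.
rewrite E1 E2 E3 E4 E5 mulNr in dis; rewrite F1 F2 F3 F4 F5 in disN.
have hE := jac_1_2 3; rewrite muln1 in hE; rewrite hE in dis disN.
have hA := jac_1_5 0; have hBB := jac_1_5_neg 0; have hC := jac_1_1 2; have hD := jac_1_1_neg 2.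
have hG := jac_1_5 1; rewrite jacC in hG.
have q1 := quartic 0; have q3 := quartic 2.
rewrite expr1 in hA hBB; rewrite /= expr1 in q1.
have [laE sE xE] : [/\ la = fdil 2 (Fps xi) + qq * fdil 2 be,
    (qq * fdil 2 be) ^+ 2 = fdil 2 (Fps xi) ^+ 2 - fdil 2 (Fps xi) &
    Fps xi = 2 * fdil 2 (Fps xi)
      + (3 - 4 * fdil 2 (Fps xi)) * (fdil 2 (Fps xi) - qq * fdil 2 be)].
  by apply: (lambda_key _ _ _ _ _ _ hA hBB hC hD hG dis disN q1 q3 hla hX hnu hM hB xiM
    (phi := fconst)); rewrite ?etaq_neq0 ?qq_neq0 //; apply: etaq_const.
split; last by split.
by have := congr1 (fun f => cf f 0) hbe; rewrite !(cfX0, cfM0) !e1 !expr1n !mulr1.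
Qed.

Lemma cf_peval (P : {poly int}) (f : ps) n : ps_peval P f n = cf (ev (Fps f) P) n.
Proof.
have intM (c : int) (g : fps) m : cf (c%:~R * g) m = c * cf g m.
  rewrite mulrzl; case: c => k; [rewrite -pmulrn | rewrite NegzE mulrNz -pmulrn cfN mulNr; congr (- _)].
    by elim: k => [|k IH]; rewrite ?mul0r // mulrS cfD IH; lia.
  by elim: k.+1 => [|k' IH]; rewrite ?mul0r // mulrS cfD IH; lia.
rewrite [ev _ _]/= /horner_eval /map_poly horner_poly cf_sum; apply: eq_bigr => k _.
by rewrite -Fps_pow intM.
Qed.

Theorem theorem3p1 :
  forall i j : nat,
    (exists P : {poly int}, forall n, zeta i j n = ps_peval P xi n) /\
    (forall P : {poly int}, (forall n, zeta i j n = ps_peval P xi n) ->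
       (forall m : nat, (m < dij i j)%N -> P`_m = 0) /\
       odd (absz (P`_(dij i j)))).
Proof.
move=> i j; have [la [be [be1 [kaE laE sE xE]]]] := key_identities.
have fU1 : fU 1 = 1.
  by apply: fpsP => n; rewrite [LHS]/= [RHS]/= /ps_U /ps_one; case: n.
have [P0 [Q P0E oddQ] Z0] := @U_low_odd fps (fdil 2) fU (fun _ _ => erefl) fU1 fU_dilM
  (Fps xi) (qq * fdil 2 be) sE (fU_qq be) xE i j.
rewrite -laE -kaE in Z0.
have zetaE n : zeta i j n = cf (ev (Fps xi) P0) n.
  by rewrite -Z0 -!Fps_pow.
have xi1 : fconst (Fps xi) = 1.
  by have := congr1 (fun f => cf f 0) xiM; rewrite !(cfX0, cfM0) !etaq_const !expr1n !mulr1.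
have xiN1 : Fps xi - 1 != 0.
  (* If [xi] were [1], then [s ^+ 2 = 0], so [s = 0]; but the coefficient of [q] in [s] is the
     constant term [1] of [be]. *)
  apply/eqP => /eqP; rewrite subr_eq0 => /eqP x1; move: sE.
  rewrite x1 (rmorph1 (fdil 2)) expr1n subrr => /eqP; rewrite expf_eq0 /= => /eqP s0.
  by have := congr1 (fun f => cf f 1) s0; rewrite cf_qqM /= /ps_dil be1.
split; first by exists P0 => n; rewrite zetaE cf_peval.
(* By [ev_inj] every polynomial representing [zeta i j] is the [P0] built by the recurrences, so its
   coefficients can be read off. *)
move=> P PE; have {PE} -> : P = P0.
  apply/eqP; rewrite -subr_eq0; apply/eqP/(ev_inj xi1 xiN1).
  by rewrite rmorphB; apply/eqP; rewrite subr_eq0; apply/eqP/fpsP => n; rewrite -cf_peval -PE zetaE.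
rewrite P0E; split=> [m lt_m|]; first by rewrite coefXnM lt_m.
by rewrite coefXnM ltnn subnn.
Qed.
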